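(* Let $(R)$ be a non-degenerate non-twin rank-$2$ root with minimal points $\mathbf a_1,\mathbf a_2$, with vectors $\mathbf v_0,\mathbf v_1$, and with limit directions $\mathbf l^-,\mathbf l^+$ (assumed to be defined). Then a full-tree configuration $(D)$ with the same minimal points $\mathbf a_1,\mathbf a_2$ and with vectors $\mathbf y_1,\mathbf y_2$ can be obtained from $(R)$ by means of slides and connections if and only if both of the following conditions hold: 1. $\langle \mathbf y_1,\mathbf y_2\rangle=\langle \mathbf v_0,\mathbf v_1\rangle$ and the pair $\mathbf y_1,\mathbf y_2$ is Nielsen equivalent to the pair $\mathbf v_0,\mathbf v_1$. 2. For $i=1,2$ we have $\nu_i\mathbf y_i=\lambda_i\mathbf l^-+\mu_i\mathbf l^+$ for some integers $\lambda_i,\mu_i\ge 0$ and $\nu_i>0$.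
   Context: Fix a finite set $\mathcal P$ of primes (the primes dividing the labels of a one-vertex two-edge generalized Baumslag–Solitar graph) and let $\mathbf A=\mathbb Z/2\mathbb Z\oplus\bigoplus_{r\in\mathcal P}\mathbb Z$. For $\mathbf a=(a_0,a_r:r\in\mathcal P)\in\mathbf A$ write $\mathbf a\ge\mathbf 0$ if $a_r\ge0$ for all $r\in\mathcal P$ (no condition on the $\mathbb Z/2\mathbb Z$-component $a_0$); $\mathbf a\ge\mathbf b$ means $\mathbf a-\mathbf b\ge\mathbf 0$; $\mathbf A^+=\{\mathbf a:\mathbf a\ge\mathbf 0\}$. $\mathbb N$ contains $0$. An (unoriented) edge joining $\mathbf p,\mathbf q\in\mathbf A^+$ is written $\mathbf p - \mathbf q$. Configurations. A configuration with minimal points $\mathbf a_1,\mathbf a_2\in\mathbf A^+$ and vectors $\mathbf x_1,\mathbf x_2\in\mathbf A$ is the pair of edges $\mathbf a_1-(\mathbf a_1+\mathbf x_1)$ (first edge) and $\mathbf a_2-(\mathbf a_2+\mathbf x_2)$ (second edge), where: $\mathbf a_1\not\ge\mathbf a_2$ and $\mathbf a_2\not\ge\mathbf a_1$; $\mathbf a_1+\mathbf x_1$ is $\ge$ at least one of $\mathbf a_1,\mathbf a_2$; $\mathbf a_2+\mathbf x_2$ is $\ge$ at least one of $\mathbf a_1,\mathbf a_2$. It is degenerate if (1) at least one of $\mathbf x_1,\mathbf x_2$ lies in $\mathbb Z/2\mathbb Z\le\mathbf A$, or (2) the edges are $\mathbf a_1-(\mathbf a_2+\mathbf e)$ and $\mathbf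 a_2-(\mathbf a_1+\mathbf e')$ with $\mathbf e,\mathbf e'\in\mathbb Z/2\mathbb Z$, or (3) $\mathbf a_1+\mathbf x_1\not\ge\mathbf a_2$ and $\mathbf a_2+\mathbf x_2\not\ge\mathbf a_1$. It is full-tree if $\mathbf a_1+\mathbf x_1$ and $\mathbf a_2+\mathbf x_2$ are both $\ge\mathbf a_1$ and $\ge\mathbf a_2$. It is rank-$2$ if $\langle\mathbf x_1,\mathbf x_2\rangle\cong\mathbb Z^2$. Sons and roots. If $\mathbf a_1+\mathbf x_1\ge\mathbf a_2$, the first son $(C1)$ of $(C)$ is the configuration with the same minimal points and vectors $\mathbf x_1+\mathbf x_2,\mathbf x_2$; if $\mathbf a_2+\mathbf x_2\ge\mathbf a_1$, the second son $(C2)$ has vectors $\mathbf x_1,\mathbf x_2+\mathbf x_1$. For a finite word $s\in\{1,2\}^*$, $(Cs)$ is the iterated son obtained by reading $s$ from left to right (if all steps are possible). A root is a configuration with $\mathbf a_1+\mathbf x_1\not\ge\mathbf a_2+\mathbf x_2$ and $\mathbf a_2+\mathbf x_2\not\ge\mathbf a_1+\mathbf x_1$. Two non-degenerate roots $(R),(Q)$ are twin roots if $(R)$ has edges $\mathbf a_1-(\mathbf a_2+\mathbf e)$, $\mathbf a_2-(\mathbf a_2+\mathbf x_2)$ and $(Q)$ has edges $\mathbf a_1-(\mathbf a_1+\mathbf x_1)$, $\mathbf a_2-(\mathbf a_1+\mathbf e)$ with $\mathbf e\in\mathbb Z/2\mathbb Z$, $\mathbf x_1,\mathbf x_2\not\ge\mathbf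 0$ and $\mathbf x_1+\lambda\mathbf a_1=\mathbf x_2+\lambda\mathbf a_2+\lambda\mathbf e$ for some integer $\lambda\ge2$. A root is non-twin if it is not a member of a pair of twin roots. Moves. Slide: replace a pair of edges $\mathbf p-\mathbf q$, $\mathbf r-(\mathbf p+\mathbf a)$ with $\mathbf a\in\mathbf A^+$ by $\mathbf p-\mathbf q$, $\mathbf r-(\mathbf q+\mathbf a)$. Connection: replace $\mathbf q-(\mathbf p+\mathbf w_1)$, $\mathbf p-(\mathbf p+\mathbf w)$, where $\mathbf w,\mathbf w_1,\mathbf w_2\in\mathbf A^+$, $k\in\mathbb N$ and $\mathbf w_1+\mathbf w_2=k\mathbf w$, by $\mathbf p-(\mathbf q+\mathbf w_2)$, $\mathbf q-(\mathbf q+\mathbf w)$. In particular, a configuration with vectors $\mathbf x_1,\mathbf x_2$ allows for a connection with the first edge controlling the endpoint of the second if $\mathbf x_1\ge\mathbf 0$ and $\mathbf a_1\le\mathbf a_2+\mathbf x_2\le\mathbf a_1+k\mathbf x_1$ for some $k\in\mathbb N$, with result the configuration with vectors $k\mathbf x_1-\mathbf x_2,\ \mathbf x_1$; it allows for a connection with the second edge controlling the endpoint of the first if $\mathbf x_2\ge\mathbf 0$ and $\mathbf a_2\le\mathbf a_1+\mathbf x_1\le\mathbf a_2+k\mathbf x_2$ for some $k\in\mathbb N$, with result the configuration with vectors $\mathbf x_2,\ k\mathbf x_2-\mathbf x_1$. Sequence of roots. For a non-degenerate root $(R)$, $(R^-)$ (resp. $(R^+)$) denotes the non-degenerate root obtained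 from $(R)$, if possible, by the connection with the first edge controlling the endpoint of the second (resp. the second controlling the first), using the minimum possible $k$. One has $(R^{-+})=(R)$ if $(R^-)$ exists, and $(R^{+-})=(R)$ if $(R^+)$ exists. Iterating gives a sequence of roots $\dots,(R^{-}),(R),(R^{+}),\dots$ (finite or infinite on each side; $(R^{+i})$, $i\in\mathbb Z$, denotes its $i$-th term) and a sequence $\dots,\mathbf v_{-1},\mathbf v_0,\mathbf v_1,\mathbf v_2,\dots$ in $\mathbf A$ such that $(R^{+i})$ has vectors $\mathbf v_i,\mathbf v_{i+1}$. Limit directions. Let $(R)$ be a non-degenerate non-twin root. If the sequence is infinite on the right, $\mathbf l^+=\mathbf v_{i+1}-\mathbf v_i$ for $i$ big enough (this is eventually constant). If it terminates on the right and some root in the sequence has a full-tree iterated son, take the maximum $i$ such that $(R^{+i})$ has a full-tree iterated son; among the finitely many words $s$ such that $(R^{+i}s)$ is full-tree and no proper initial segment $s'$ of $s$ has $(R^{+i}s')$ full-tree, take the unique one beginning with the most digits $2$, and let $\mathbf l^+$ be the second vector of $(R^{+i}s)$. If no root in the sequence has a full-tree iterated son, $\mathbf l^+$ is not defined. Symmetrically: if the sequence is infinite on the left, $\mathbf l^-=\mathbf v_{i-1}-\mathbf v_i$ for $i$ negative enough; if it terminates on the left and some root has a full-tree iterated son, take the minimum $i$ such that $(R^{+i})$ has a full-tree iterated son; among the finitely many words $s$ such that $(R^{+i}s)$ is full-tree and no proper initial segment $s'$ of $s$ has $(R^{+i}s')$ full-tree, take the unique one beginning with the most digits $1$, and let $\mathbf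 l^-$ be the first vector of $(R^{+i}s)$; otherwise $\mathbf l^-$ is not defined. Nielsen equivalence of ordered pairs of elements of $\mathbf A$ is the equivalence relation generated by $(\mathbf x_1,\mathbf x_2)\sim(\mathbf x_1\pm\mathbf x_2,\mathbf x_2)$ and $(\mathbf x_1,\mathbf x_2)\sim(\mathbf x_1,\mathbf x_2\pm\mathbf x_1)$.
   Formalization: In the terminating case the digits are exchanged: l^+ uses the minimal full-tree word beginning with most digits 1, and l^- the one with most digits 2 (as written the claim fails); ties between words are broken at the first differing digit. *)

(* Defs.v *)
From mathcomp Require Import all_boot all_order all_algebra.
From mathcomp Require Import finmap.
From Stdlib Require Import Relations.

Set Implicit Arguments.
Unset Strict Implicit.
Unset Printing Implicit Defensive.

Import Order.TTheory GRing.Theory Num.Theory.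
Local Open Scope ring_scope.

Definition A (P : {fset nat}) : zmodType := ('Z_2 * {ffun P -> int})%type.

Definition nonneg (P : {fset nat}) (a : A P) : bool := [forall r : P, 0 <= a.2 r].

Definition geA (P : {fset nat}) (a b : A P) : bool := nonneg (a - b).

(* The inclusion of Z/2Z in A. *)
Definition tors (P : {fset nat}) (e : 'Z_2) : A P := (e, 0).

Definition in_tors (P : {fset nat}) (x : A P) : bool :=
  [exists e : 'Z_2, x == tors P e].

(* The subgroup generated by x1 and x2. *)
Definition span2 (P : {fset nat}) (x1 x2 a : A P) : Prop :=
  exists m n : int, a = x1 *~ m + x2 *~ n.

Definition same_span (P : {fset nat}) (x1 x2 y1 y2 : A P) : Prop :=
  forall a : A P, span2 x1 x2 a <-> span2 y1 y2 a.

Definition nielsen_step (P : {fset nat}) (x y : A P * A P) : Prop :=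
  y = (x.1 + x.2, x.2) \/ y = (x.1 - x.2, x.2) \/
  y = (x.1, x.2 + x.1) \/ y = (x.1, x.2 - x.1).

Definition nielsen_equiv (P : {fset nat}) (x y : A P * A P) : Prop :=
  clos_refl_sym_trans _ (@nielsen_step P) x y.

(* The pair of edges pt1 - (pt1 + vec1), pt2 - (pt2 + vec2); the conditions
   making it a configuration are in is_configuration. *)
Record config (P : {fset nat}) := Config {
  pt1 : A P; pt2 : A P; vec1 : A P; vec2 : A P }.

Definition end1 (P : {fset nat}) (C : config P) : A P := pt1 C + vec1 C.
Definition end2 (P : {fset nat}) (C : config P) : A P := pt2 C + vec2 C.

Definition is_configuration (P : {fset nat}) (C : config P) : bool :=
  [&& nonneg (pt1 C), nonneg (pt2 C),
      ~~ geA (pt1 C) (pt2 C), ~~ geA (pt2 C) (pt1 C),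
      geA (end1 C) (pt1 C) || geA (end1 C) (pt2 C)
    & geA (end2 C) (pt1 C) || geA (end2 C) (pt2 C)].

Definition degenerate (P : {fset nat}) (C : config P) : bool :=
  [|| in_tors (vec1 C) || in_tors (vec2 C),
      [exists e : 'Z_2, end1 C == pt2 C + tors P e] &&
      [exists e' : 'Z_2, end2 C == pt1 C + tors P e']
    | ~~ geA (end1 C) (pt2 C) && ~~ geA (end2 C) (pt1 C)].

Definition full_tree (P : {fset nat}) (C : config P) : bool :=
  [&& is_configuration C,
      geA (end1 C) (pt1 C), geA (end1 C) (pt2 C),
      geA (end2 C) (pt1 C) & geA (end2 C) (pt2 C)].

(* The subgroup generated by the two vectors is isomorphic to Z^2. *)
Definition rank2 (P : {fset nat}) (C : config P) : Prop :=
  exists f : {additive (int * int)%type -> A P},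
    injective f /\ forall a, span2 (vec1 C) (vec2 C) a <-> exists z, f z = a.

(* Words in {1,2} are sequences of booleans: false is the digit 1 and true is
   the digit 2. *)
Definition son (P : {fset nat}) (d : bool) (C : config P) : option (config P) :=
  if d then
    if geA (end2 C) (pt1 C)
    then Some (Config (pt1 C) (pt2 C) (vec1 C) (vec2 C + vec1 C)) else None
  else
    if geA (end1 C) (pt2 C)
    then Some (Config (pt1 C) (pt2 C) (vec1 C + vec2 C) (vec2 C)) else None.

Fixpoint iterated_son (P : {fset nat}) (C : config P) (s : seq bool) :
    option (config P) :=
  if s is d :: s' then
    if son d C is Some C' then iterated_son C' s' else None
  else Some C.

Definition full_tree_word (P : {fset nat}) (C : config P) (s : seq bool) : bool :=
  if iterated_son C s is Some D then full_tree D else false.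

Definition has_full_tree_son (P : {fset nat}) (C : config P) : Prop :=
  exists s, full_tree_word C s.

Definition minimal_full_tree_word (P : {fset nat}) (C : config P)
    (s : seq bool) : Prop :=
  full_tree_word C s /\
  forall s', prefix s' s -> s' != s -> ~~ full_tree_word C s'.

(* At the first digit where s and t differ, s has d. *)
Definition before (d : bool) (s t : seq bool) : Prop :=
  exists u s' t', s = u ++ d :: s' /\ t = u ++ ~~ d :: t'.

(* The minimal full-tree words of C form a prefix-free set. Among them, the
   word beginning with the most digits d is selected: it has the longest
   initial run of digits d, and ties (such as between 21 and 221 when d is 1)
   are resolved by looking at the first digit where the words differ. *)
Definition extremal_word (P : {fset nat}) (d : bool) (C : config P)
    (s : seq bool) : Prop :=
  minimal_full_tree_word C s /\
  forall t, minimal_full_tree_word C t -> t != s -> before d s t.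

Definition is_root (P : {fset nat}) (C : config P) : bool :=
  [&& is_configuration C, ~~ geA (end1 C) (end2 C) & ~~ geA (end2 C) (end1 C)].

Definition nondegenerate_root (P : {fset nat}) (C : config P) : bool :=
  is_root C && ~~ degenerate C.

Definition twin_roots (P : {fset nat}) (R Q : config P) : Prop :=
  nondegenerate_root R /\ nondegenerate_root Q /\
  exists (a1 a2 x1 x2 : A P) (e : 'Z_2) (lambda : int),
    [/\ R = Config a1 a2 (a2 + tors P e - a1) x2,
        Q = Config a1 a2 x1 (a1 + tors P e - a2),
        ~~ nonneg x1 /\ ~~ nonneg x2,
        2 <= lambda
      & x1 + a1 *~ lambda = x2 + a2 *~ lambda + tors P e *~ lambda].

Definition non_twin (P : {fset nat}) (R : config P) : Prop :=
  ~ exists Q, twin_roots R Q \/ twin_roots Q R.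

Definition edge (P : {fset nat}) : Type := (A P * A P)%type.

(* Edges are unoriented, and so are pairs of edges unordered: same_edge and
   same_edges are equality of the underlying objects. *)
Definition same_edge (P : {fset nat}) (e f : edge P) : Prop :=
  f = e \/ f = (e.2, e.1).

Definition same_edges (P : {fset nat}) (g h : edge P * edge P) : Prop :=
  (same_edge g.1 h.1 /\ same_edge g.2 h.2) \/
  (same_edge g.1 h.2 /\ same_edge g.2 h.1).

Definition slide (P : {fset nat}) (g h : edge P * edge P) : Prop :=
  exists p q r a : A P,
    [/\ [&& nonneg p, nonneg q, nonneg r & nonneg a],
        same_edges g ((p, q), (r, p + a))
      & same_edges h ((p, q), (r, q + a))].

Definition connection (P : {fset nat}) (g h : edge P * edge P) : Prop :=
  exists (p q w w1 w2 : A P) (k : nat),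
    [/\ [&& nonneg p, nonneg q, nonneg w, nonneg w1 & nonneg w2],
        w1 + w2 = w *+ k,
        same_edges g ((q, p + w1), (p, p + w))
      & same_edges h ((p, q + w2), (q, q + w))].

Definition move (P : {fset nat}) (g h : edge P * edge P) : Prop :=
  slide g h \/ connection g h.

Definition edges (P : {fset nat}) (C : config P) : edge P * edge P :=
  ((pt1 C, end1 C), (pt2 C, end2 C)).

(* D can be obtained from C by means of slides and connections. *)
Definition obtainable (P : {fset nat}) (C D : config P) : Prop :=
  exists2 g, clos_refl_trans _ (@move P) (edges C) g & same_edges g (edges D).

(* C allows for a connection with the first edge controlling the endpoint of
   the second, with parameter k; then the same with the edges exchanged. *)
Definition controls12 (P : {fset nat}) (C : config P) (k : nat) : bool :=
  [&& nonneg (vec1 C), geA (end2 C) (pt1 C)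
    & geA (pt1 C + vec1 C *+ k) (end2 C)].
Definition controls21 (P : {fset nat}) (C : config P) (k : nat) : bool :=
  [&& nonneg (vec2 C), geA (end1 C) (pt2 C)
    & geA (pt2 C + vec2 C *+ k) (end1 C)].

(* root_minus R Q means that (R^-) exists and is Q; root_plus R Q means that
   (R^+) exists and is Q. *)
Definition root_minus (P : {fset nat}) (R Q : config P) : Prop :=
  [/\ nondegenerate_root R, nondegenerate_root Q
    & exists k : nat,
        [/\ controls12 R k, forall j, controls12 R j -> (k <= j)%N
          & Q = Config (pt1 R) (pt2 R) (vec1 R *+ k - vec2 R) (vec1 R)]].
Definition root_plus (P : {fset nat}) (R Q : config P) : Prop :=
  [/\ nondegenerate_root R, nondegenerate_root Q
    & exists k : nat,
        [/\ controls21 R k, forall j, controls21 R j -> (k <= j)%N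
          & Q = Config (pt1 R) (pt2 R) (vec2 R) (vec2 R *+ k - vec1 R)]].

Fixpoint iter_rel (T : Type) (r : T -> T -> Prop) (n : nat) (x y : T) : Prop :=
  if n is n'.+1 then exists2 z, r x z & iter_rel r n' z y else y = x.

(* root_seq R i Q means that (R^{+i}) exists and is Q. *)
Definition root_seq (P : {fset nat}) (R : config P) (i : int) (Q : config P) :
    Prop :=
  match i with
  | Posz n => iter_rel (@root_plus P) n R Q
  | Negz n => iter_rel (@root_minus P) n.+1 R Q
  end.

Definition infinite_right (P : {fset nat}) (R : config P) : Prop :=
  forall i : int, 0 <= i -> exists Q, root_seq R i Q.
Definition infinite_left (P : {fset nat}) (R : config P) : Prop :=
  forall i : int, i <= 0 -> exists Q, root_seq R i Q.

(* limit_right R l means that the limit direction l^+ of R is defined and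
   equal to l; likewise limit_left R l for l^-. The vectors of (R^{+i}) are
   v_i and v_(i+1).
   If the minimal full-tree words of a root are 2, 12, 112, then the full-tree
   configurations have vectors (x1, x1 + x2), (x1 + x2, x1 + 2 x2) and
   (x1 + 2 x2, x1 + 3 x2): the outermost direction on the side of the second
   vector is the second vector of the word with the most initial digits 1, and
   the outermost one on the side of the first vector is the first vector of the
   word with the most initial digits 2. Hence l^+ uses false (the digit 1) and
   l^- uses true (the digit 2). Exchanging the two digits would not give the
   extremal directions: (x1, x1 + x2) would lie outside the cone of l^-, l^+. *)
Definition limit_right (P : {fset nat}) (R : config P) (l : A P) : Prop :=
  (infinite_right R /\
   exists N : int, forall i Q, N <= i -> root_seq R i Q ->
     l = vec2 Q - vec1 Q)
  \/
  (~ infinite_right R /\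
   exists i Q s D,
     [/\ root_seq R i Q /\ has_full_tree_son Q,
         forall j Q', root_seq R j Q' -> has_full_tree_son Q' -> j <= i,
         extremal_word false Q s,
         iterated_son Q s = Some D
       & l = vec2 D]).

Definition limit_left (P : {fset nat}) (R : config P) (l : A P) : Prop :=
  (infinite_left R /\
   exists N : int, forall i Q, i <= N -> root_seq R i Q ->
     l = vec1 Q - vec2 Q)
  \/
  (~ infinite_left R /\
   exists i Q s D,
     [/\ root_seq R i Q /\ has_full_tree_son Q,
         forall j Q', root_seq R j Q' -> has_full_tree_son Q' -> i <= j,
         extremal_word true Q s,
         iterated_son Q s = Some D
       & l = vec1 D]).

(* Main.v *)
Require Import Defs.
From mathcomp Require Import all_boot all_order all_algebra.
From mathcomp Require Import finmap zify ring.
From Stdlib Require Import Relations.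

Set Implicit Arguments.
Unset Strict Implicit.
Unset Printing Implicit Defensive.

Import Order.TTheory GRing.Theory Num.Theory.
Local Open Scope ring_scope.

(** Let d = a2 - a1. A configuration with minimal points a1 and a2 is a pair of
    vectors (x1, x2), and everything is governed by three conditions: x >= 0,
    x >= d and x >= - d. The first son exists when x1 >= d, the second when
    x2 >= - d; full-tree means x1 >= 0, x1 >= d, x2 >= 0 and x2 >= - d.

    The moves. Call a configuration proper when no minimal point is >= an end.
    Then minimal points cannot be slid, so that every slide leads to a son or
    back to a father, and a connection between iterated sons is, up to slides,
    the connection of the root they come from. A non-degenerate root of rank 2
    that is not proper has an edge a1 - (a2 + e) (or the mirror image), and
    then a twin can be written down (twin_exists). So the configurations
    obtained from (R) are exactly the iterated sons of the roots of its
    sequence (reached_move, reached_obtainable). Sons and connections act on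
    the pair of vectors by integer matrices of determinant 1, which gives the
    Nielsen equivalence.

    The cone. All vectors lie in the lattice spanned by v_0 and v_1, a copy of
    Z^2, where the determinant (wedge) compares directions. The vectors of
    iterated sons of (R^{+i}) lie in the cone of v_i, v_{i+1}. The v_i turn in
    one direction, and convexly, because connections between roots have
    parameter at least 2 (chain_wedge). Hence every full-tree configuration
    obtained lies between the limit directions (right_limit, left_limit).

    The converse. The sons of a full-tree configuration are full-tree, so two
    full-tree configurations whose cones overlap have a common iterated son,
    and each is obtained from the other (overlap_linked). It remains to see
    that the full-tree configurations obtained from (R) leave no gap between
    the limit directions (cover_tree, cover_chain). A gap could only occur at
    a vector separating two sons, or two successive roots, both with full-tree
    iterated sons; but such a vector satisfies all three conditions, and then
    it belongs to full-tree configurations on both of its sides.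

    Exchanging the two edges (swap) turns each statement about the left side
    into one about the right side. *)

(** * The order, entry by entry *)

Definition entry (P : {fset nat}) (r : P) (a : A P) : int := a.2 r.

Lemma entryD (P : {fset nat}) (r : P) (a b : A P) :
  entry r (a + b) = entry r a + entry r b.
Proof. by rewrite /entry ffunE. Qed.

Lemma entryN (P : {fset nat}) (r : P) (a : A P) : entry r (- a) = - entry r a.
Proof. by rewrite /entry ffunE. Qed.

Lemma entry0 (P : {fset nat}) (r : P) : entry r (0 : A P) = 0.
Proof. by rewrite /entry ffunE. Qed.

Lemma entry_tors (P : {fset nat}) (r : P) (e : 'Z_2) : entry r (tors P e) = 0.
Proof. by rewrite /entry ffunE. Qed.

Lemma entryMn (P : {fset nat}) (r : P) (a : A P) (n : nat) :
  entry r (a *+ n) = entry r a * n%:Z.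
Proof.
elim: n => [|n IH]; first by rewrite mulr0n entry0 mulr0.
by rewrite mulrS entryD IH; lia.
Qed.

Lemma entryMz (P : {fset nat}) (r : P) (a : A P) (m : int) :
  entry r (a *~ m) = entry r a * m.
Proof.
case: m => n; first by rewrite -pmulrn entryMn.
by rewrite NegzE mulrNz -pmulrn entryN entryMn mulrN.
Qed.

Definition entryE := (entryD, entryN, entry0, entry_tors, entryMn, entryMz).

Lemma geAP (P : {fset nat}) (a b : A P) :
  reflect (forall r, entry r b <= entry r a) (geA a b).
Proof.
apply: (iffP forallP) => H r; have := H r; rewrite -/(entry r (a - b)) !entryE;
  lia.
Qed.

Lemma nonnegP (P : {fset nat}) (a : A P) :
  reflect (forall r, 0 <= entry r a) (nonneg a).
Proof. exact: forallP. Qed.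

Lemma A_ext (P : {fset nat}) (a b : A P) :
  a.1 = b.1 -> (forall r, entry r a = entry r b) -> a = b.
Proof. by case: a b => [a f] [b g] /= -> fg; congr pair; apply/ffunP. Qed.

(** The solver translates the whole context, which is therefore cleared first,
    except for the inequalities between natural numbers. *)
Ltac clear_lia :=
  repeat match goal with
  | H : ?T |- _ =>
    lazymatch T with is_true (leq _ _) => fail | _ => clear H end
  end;
  lia.

(** Linear arithmetic on the entries occurring in the goal; bare integer
    variables keep the solver fast. *)
Ltac entry_lia :=
  rewrite ?entryE;
  repeat match goal with
  | |- context [entry ?r ?a] => generalize (entry r a)
  end;
  clear_lia.

(** Domination is checked entry by entry, using all the dominations known in
    the context. *)
Ltac geA_lia :=
  unfold end1, end2 in *; cbn [pt1 pt2 vec1 vec2] in *;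
  match goal with
  | |- is_true (geA _ _) => apply/geAP
  | |- is_true (nonneg _) => apply/nonnegP
  end;
  let r := fresh "r" in
  move=> r;
  repeat match goal with
  | H : is_true (geA _ _) |- _ => move/geAP/(_ r): H
  | H : is_true (nonneg _) |- _ => move/nonnegP/(_ r): H
  end;
  entry_lia.

Lemma geA_refl (P : {fset nat}) (a : A P) : geA a a.
Proof. by apply/geAP. Qed.

Lemma nonnegMn (P : {fset nat}) (a : A P) (n : nat) : nonneg a ->
  nonneg (a *+ n).
Proof. by move=> /nonnegP a0; apply/nonnegP => r; rewrite entryMn mulr_ge0. Qed.

Ltac A_ring := apply: A_ext => [|?]; [rewrite /=; ring | entry_lia].

(** * Exchanging the two edges *)

(** Exchanging the edges exchanges the digits 1 and 2, the two directions of
    the sequence of roots and the two limit directions, so that every argument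
    has to be made on one side only. *)
Definition swap (P : {fset nat}) (C : config P) : config P :=
  Config (pt2 C) (pt1 C) (vec2 C) (vec1 C).

Lemma swapK (P : {fset nat}) : involutive (@swap P).
Proof. by case. Qed.

Lemma son_swap (P : {fset nat}) d (C : config P) :
  son d (swap C) = omap (@swap P) (son (~~ d) C).
Proof. by case: d; rewrite /son /swap /end1 /end2 /=; case: ifP. Qed.

Lemma iterated_son_swap (P : {fset nat}) s (C : config P) :
  iterated_son (swap C) s = omap (@swap P) (iterated_son C (map negb s)).
Proof. by elim: s C => //= d s IH C; rewrite son_swap; case: son => //=. Qed.

Lemma is_configuration_swap (P : {fset nat}) (C : config P) :
  is_configuration (swap C) = is_configuration C.
Proof.
rewrite /is_configuration /swap /end1 /end2 /=.
by do 2!case: (nonneg _); do 6!case: (geA _ _).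
Qed.

Lemma full_tree_swap (P : {fset nat}) (C : config P) :
  full_tree (swap C) = full_tree C.
Proof.
rewrite /full_tree is_configuration_swap /swap /end1 /end2 /=.
by case: is_configuration; do 4!case: (geA _ _).
Qed.

Lemma nondegenerate_root_swap (P : {fset nat}) (C : config P) :
  nondegenerate_root (swap C) = nondegenerate_root C.
Proof.
rewrite /nondegenerate_root /is_root /degenerate is_configuration_swap.
rewrite /swap /end1 /end2 /=.
rewrite (orbC (in_tors (vec2 C))) (andbC (~~ geA (pt2 C + vec2 C) (pt1 C))).
rewrite (andbC [exists e, pt2 C + vec2 C == _]).
by rewrite (andbC (~~ geA (pt2 C + vec2 C) _)).
Qed.

Lemma root_minus_swap (P : {fset nat}) (R Q : config P) :
  root_minus (swap R) (swap Q) <-> root_plus R Q.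
Proof.
rewrite /root_minus /root_plus !nondegenerate_root_swap; split.
  move=> [rR rQ [k [ctl kmin eqQ]]]; split=> //; exists k; split=> //.
  by rewrite -[Q]swapK eqQ.
by move=> [rR rQ [k [ctl kmin eqQ]]]; split=> //; exists k; split;
  rewrite // eqQ.
Qed.

Lemma iter_rel_swap (P : {fset nat}) n (R Q : config P) :
  iter_rel (@root_minus P) n (swap R) (swap Q) <-> iter_rel (@root_plus P) n R
    Q.
Proof.
elim: n R => [|n IH] R /=; first by split=> [/(can_inj (@swapK P))|->].
split=> [[Z RZ ZQ]|[Z /root_minus_swap RZ /IH ZQ]]; last by exists (swap Z).
by exists (swap Z); [apply/root_minus_swap|apply/IH]; rewrite swapK.
Qed.

Lemma root_seq_swap (P : {fset nat}) (R : config P) i (Q : config P) :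
  root_seq (swap R) (- i) (swap Q) <-> root_seq R i Q.
Proof.
case: i => [[|n]|n].
- by rewrite oppr0 /=; split=> [/(can_inj (@swapK P))|->].
- exact: iter_rel_swap.
- rewrite NegzE opprK /root_seq.
  by have := iter_rel_swap n.+1 (swap R) (swap Q); rewrite !swapK; tauto.
Qed.

Lemma full_tree_word_swap (P : {fset nat}) (C : config P) s :
  full_tree_word (swap C) s = full_tree_word C (map negb s).
Proof.
rewrite /full_tree_word iterated_son_swap.
by case: iterated_son => //= D; rewrite full_tree_swap.
Qed.

Lemma minimal_word_swap (P : {fset nat}) (C : config P) s :
  minimal_full_tree_word C s -> minimal_full_tree_word (swap C) (map negb s).
Proof.
move=> [full_s min_s]; split; first by rewrite full_tree_word_swap (mapK negbK).
move=> s' /prefixP[t eq_s] neq_s; rewrite full_tree_word_swap.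
apply: min_s.
  by rewrite -[s](mapK negbK) eq_s map_cat prefix_prefix.
by apply: contra neq_s => /eqP<-; rewrite (mapK negbK).
Qed.

Lemma extremal_word_swap (P : {fset nat}) d (C : config P) s :
  extremal_word d C s -> extremal_word (~~ d) (swap C) (map negb s).
Proof.
move=> [min_s ext_s]; split; first exact: minimal_word_swap.
move=> t /minimal_word_swap; rewrite swapK => min_t neq_t.
have /ext_s : map negb t != s.
  by apply: contra neq_t => /eqP<-; rewrite (mapK negbK).
case/(_ min_t) => u [s' [t' [-> eq_t]]].
exists (map negb u), (map negb s'), (map negb t').
by rewrite -[t](mapK negbK) eq_t !map_cat.
Qed.

Lemma has_full_tree_son_swap (P : {fset nat}) (C : config P) :
  has_full_tree_son C -> has_full_tree_son (swap C).
Proof. by move=> [s s_full]; exists (map negb s);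
  rewrite full_tree_word_swap (mapK negbK). Qed.

Lemma infinite_swap (P : {fset nat}) (R : config P) :
  infinite_right (swap R) <-> infinite_left R.
Proof.
split=> inf i i0.
  have [|Q RQ] := inf (- i); first by rewrite oppr_ge0.
  by exists (swap Q); apply/root_seq_swap; rewrite swapK.
have [|Q RQ] := inf (- i); first by rewrite oppr_le0.
by exists (swap Q); rewrite -[i]opprK; apply/root_seq_swap.
Qed.

Lemma limit_left_swap (P : {fset nat}) (R : config P) l :
  limit_left R l -> limit_right (swap R) l.
Proof.
case=> [[inf [N lN]]|[fin [i [Q [s [D [[RQ fQ] max_i ext_s sD ->]]]]]]].
  left; split; first exact/infinite_swap.
  exists (- N) => i Q le_i RQ; apply: (lN (- i) (swap Q)).
    by rewrite lerNl.
  by apply/root_seq_swap; rewrite swapK opprK.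
right; split; first by move/infinite_swap.
exists (- i), (swap Q), (map negb s), (swap D); split=> //.
- by split; [apply/root_seq_swap|apply: has_full_tree_son_swap].
- move=> j Q' RQ' fQ'; rewrite lerNr; apply: (max_i _ (swap Q')).
    by apply/root_seq_swap; rewrite swapK opprK.
  exact: has_full_tree_son_swap.
- exact: (extremal_word_swap ext_s).
- by rewrite iterated_son_swap (mapK negbK) sD.
Qed.

(** * Twin roots and proper configurations *)

Lemma in_torsP (P : {fset nat}) (x : A P) :
  (forall r, entry r x = 0) -> in_tors x.
Proof.
move=> x0; apply/existsP; exists x.1; apply/eqP.
by apply: A_ext => // r; rewrite entry_tors.
Qed.

Lemma geA_antisym (P : {fset nat}) (a b : A P) :
  geA a b -> geA b a -> exists e, a = b + tors P e.
Proof.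
move=> /geAP ab /geAP ba; exists (a.1 - b.1); apply: A_ext => [|r] /=.
  by rewrite addrC subrK.
by have := ab r; have := ba r; rewrite entryD entry_tors; lia.
Qed.

Lemma pairMz (z : int * int) p : z *~ p = (z.1 * p, z.2 * p).
Proof.
rewrite [LHS]surjective_pairing (raddfMz (@fst int int)) (raddfMz (@snd int
  int)).
by rewrite !mulrzz.
Qed.

Lemma rank2_free (P : {fset nat}) (C : config P) (m n : int) :
  rank2 C -> vec1 C *~ m + vec2 C *~ n = 0 -> m = 0 /\ n = 0.
Proof.
case=> f [inj_f im_f].
have [z1 f1] : exists z, f z = vec1 C.
  by apply/im_f; exists 1, 0; rewrite mulr1z mulr0z addr0.
have [z2 f2] : exists z, f z = vec2 C.
  by apply/im_f; exists 0, 1; rewrite mulr1z mulr0z add0r.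
have comb p q : vec1 C *~ p + vec2 C *~ q = f (z1 *~ p + z2 *~ q).
  by rewrite raddfD !raddfMz f1 f2.
(* The coordinates of the two vectors form a unimodular matrix. *)
have unimod z : exists p q, z1 *~ p + z2 *~ q = z.
  have /im_f[p [q eq_pq]] : exists z', f z' = f z by exists z.
  by exists p, q; apply: inj_f; rewrite -comb -eq_pq.
have [p [q pq]] := unimod (1, 0); have [p' [q' pq']] := unimod (0, 1).
rewrite comb -(raddf0 f) => /inj_f mn.
move: (congr1 fst pq) (congr1 snd pq) (congr1 fst pq') (congr1 snd pq').
move: (congr1 fst mn) (congr1 snd mn).
rewrite /= !pairMz /=; case: z1 z2 {f1 f2 comb unimod pq pq' mn} => a b [c d]
  /=.
move=> E1 E2 F1 F2 F3 F4.
have det : (a * d - b * c) * (p * q' - p' * q) = 1.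
  by transitivity ((a * p + c * q)*(b * p' + d * q') - (b * p + d * q)*(a * p'
    + c * q')); [ring|rewrite F1 F2 F3 F4].
have nz : a * d - b * c != 0.
  by apply/eqP => det0; rewrite det0 mul0r in det.
have m0 : (a * d - b * c) * m = 0.
  by transitivity (d * (a * m + c * n) - c * (b * m + d * n));
    [ring|rewrite E1 E2; ring].
have n0 : (a * d - b * c) * n = 0.
  by transitivity (a * (b * m + d * n) - b * (a * m + c * n));
    [ring|rewrite E1 E2; ring].
by move/eqP: m0; move/eqP: n0; rewrite !mulf_eq0 (negPf nz) => /eqP-> /eqP->.
Qed.

Lemma tors_double (P : {fset nat}) (e : 'Z_2) : tors P e + tors P e = 0.
Proof.
apply: A_ext => [|r]; last by rewrite !entryE.
by apply/val_inj; case: e => [[|[|?]] ?].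
Qed.

Lemma rank2_swap (P : {fset nat}) (C : config P) : rank2 C -> rank2 (swap C).
Proof.
case=> f [inj_f im_f]; exists f; split; first exact: inj_f.
move=> a; apply: iff_trans (im_f a).
by split=> -[m [n ->]]; exists n, m; rewrite addrC.
Qed.

Lemma twin_roots_swap (P : {fset nat}) (R Q : config P) :
  twin_roots R Q -> twin_roots (swap Q) (swap R).
Proof.
move=> [rR [rQ [a1 [a2 [x1 [x2 [e [la [eR eQ [x1n x2n] la2 eq_la]]]]]]]]].
split; first by rewrite nondegenerate_root_swap.
split; first by rewrite nondegenerate_root_swap.
exists a2, a1, x2, x1, e, la; split;
  [by rewrite eQ|by rewrite eR|by split|exact: la2|].
have ee : tors P e *~ la + tors P e *~ la = 0.
  by rewrite -mulrzDl tors_double mul0rz.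
by move: (_ *~ _) (a1 *~ _) (a2 *~ _) eq_la ee => t n n' -> ee;
  rewrite -addrA ee addr0.
Qed.

Lemma non_twin_swap (P : {fset nat}) (R : config P) :
  non_twin R -> non_twin (swap R).
Proof.
move=> ntw [Q tw]; apply: ntw; exists (swap Q).
by case: tw => /twin_roots_swap; rewrite swapK; [right|left].
Qed.

(** Sliding the second edge along the edge a1 - (a2 + e) adds d = a2 + e - a1
    to the second vector. As x2 >= - d, one slide makes it nonnegative, and as
    d is not nonnegative it does not stay so. The first x2 + m d that fails to
    be nonnegative again is the first vector of the twin, with lambda = m. *)
Lemma twin_exists (P : {fset nat}) (a1 a2 x2 : A P) (e : 'Z_2) :
  nondegenerate_root (Config a1 a2 (a2 + tors P e - a1) x2) ->
  rank2 (Config a1 a2 (a2 + tors P e - a1) x2) ->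
  exists Q, twin_roots (Config a1 a2 (a2 + tors P e - a1) x2) Q.
Proof.
move=> ndR rk2; have := ndR.
rewrite /nondegenerate_root /is_root /is_configuration /end1 /end2 /=.
case/andP=> /and3P[/and5P[a1n a2n n12 n21 /andP[_ c2]] nge12 nge21] _.
pose d := a2 + tors P e - a1; pose z n := x2 + d *+ n.
have x2n : ~~ nonneg x2.
  by apply: contra nge21 => x2n; geA_lia.
have g2 : geA (a2 + x2) a1.
  by case/orP: c2 => // g2; case/negP: x2n; geA_lia.
have [n0 n0P] : exists n, (0 < n)%N && ~~ nonneg (z n).
  have [r dr] : exists r, entry r a2 < entry r a1.
    move: n21; rewrite /geA /nonneg negb_forall => /existsP[r].
    by rewrite -/(entry r _) !entryE -ltNge => dr; exists r; move: dr; clear;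
      lia.
  exists `|entry r x2|.+1 => /=; apply/negP=> /nonnegP/(_ r).
  rewrite /z /d !entryE.
  move: (entry r a1) (entry r a2) (entry r x2) dr => b1 b2 b.
  clear; nia.
have exn : exists n, (0 < n)%N && ~~ nonneg (z n) by exists n0.
case: (ex_minnP exn) => m /andP[m_gt0 zm] m_min.
have m_neq1 : m != 1%N.
  by apply: contraNneq zm => ->; rewrite /z /d; geA_lia.
have [m' m'0 Em] : exists2 m', (0 < m')%N & m = m'.+1 by clear -m_neq1 m_gt0;
  case: m m_neq1 m_gt0 => [|[|m]] // _ _; exists m.+1.
have zm' : nonneg (z m').
  apply: contraT => nzm'; have := m_min m'.
  by rewrite m'0 nzm' Em ltnn => /(_ isT).
have ge_zm : geA (a1 + z m) a2 by rewrite /z Em in zm' *; rewrite /d in zm' *;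
  geA_lia.
exists (Config a1 a2 (z m) (a1 + tors P e - a2)); split=> //; split.
  rewrite /nondegenerate_root /is_root /is_configuration /end1 /end2 /= a1n a2n
    n12 n21 ge_zm orbT /=.
  have -> /= : geA (a2 + (a1 + tors P e - a2)) a1 by geA_lia.
  have -> /= : ~~ geA (a1 + z m) (a2 + (a1 + tors P e - a2)).
    by apply: contra zm => H; geA_lia.
  have -> /= : ~~ geA (a2 + (a1 + tors P e - a2)) (a1 + z m).
    by apply: contra n12 => H; geA_lia.
  rewrite /degenerate /end1 /end2 /= ge_zm /=.
  have in_tors0 (x : A P) r : in_tors x -> entry r x = 0.
    by case/existsP=> e' /eqP->; rewrite entry_tors.
  apply/norP; split; last (apply/norP; split).
  - apply/norP; split.
      by apply: contra zm => ts; apply/nonnegP=> r; rewrite in_tors0.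
    apply: contra n12 => ts; apply/geAP=> r; have := in_tors0 _ r ts.
    entry_lia.
  - apply/negP=> /andP[/existsP[e' /eqP e1] _].
    (* A coincidence of the ends makes the vectors of R dependent. *)
    have dep : forall r, entry r (x2 + d *+ m') = 0.
      by move=> r; move: (congr1 (entry r) e1); rewrite /z Em /d; entry_lia.
    have [e'' eq_e''] : exists e'', x2 + d *+ m' = tors P e''.
      by have /existsP[e'' /eqP] := in_torsP dep; exists e''.
    have : (a2 + tors P e - a1) *~ (m' + m')%:Z + x2 *~ 2 = 0.
      rewrite -!pmulrn mulr2n addrC mulrnDr addrACA.
      by rewrite eq_e'' tors_double.
    by case/(rank2_free rk2).
  - by [].
exists a1, a2, (z m), x2, e, m%:Z.
split; [by []|by []|by split|by move: m'0; rewrite Em; clear; lia|].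
rewrite /z /d -!pmulrn mulrnBl mulrnDl.
by rewrite !addrA subrK.
Qed.

(** Otherwise a minimal point could be slid along the edge of the end that it
    dominates, or an edge could act as a loop based at its other end, and the
    moves would lead to pairs of edges of another shape. *)
Definition proper (P : {fset nat}) (C : config P) : bool :=
  [&& ~~ geA (pt1 C) (end1 C), ~~ geA (pt1 C) (end2 C),
      ~~ geA (pt2 C) (end1 C) & ~~ geA (pt2 C) (end2 C)].

Lemma proper_swap (P : {fset nat}) (C : config P) : proper (swap C) = proper C.
Proof.
rewrite /proper /swap /end1 /end2 /=.
by do 4!case: (geA _ _).
Qed.

Lemma root_vec1_proper (P : {fset nat}) (R : config P) :
  nondegenerate_root R -> ~~ geA (pt1 R) (end1 R).
Proof.
case: R => a1 a2 x1 x2; rewrite /nondegenerate_root /is_root /is_configuration.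
rewrite /degenerate /end1 /end2 /=.
case/andP=> /and3P[/and5P[_ _ n12 n21 /andP[c1 _]] _ _] /norP[/norP[ntors _] _].
apply: contra ntors => le_x1; case/orP: c1 => c1.
  apply/in_torsP => r; move/geAP/(_ r): le_x1; move/geAP/(_ r): c1.
  entry_lia.
by case/negP: n12; geA_lia.
Qed.

(** If a2 >= a1 + x1 then the two agree up to torsion, the case of twins. *)
Lemma root_end1_proper (P : {fset nat}) (R : config P) :
  nondegenerate_root R -> non_twin R -> rank2 R -> ~~ geA (pt2 R) (end1 R).
Proof.
case: R => a1 a2 x1 x2 ndR ntw rk2; have := ndR.
rewrite /nondegenerate_root /is_root /is_configuration /end1 /end2 /=.
case/andP=> /and3P[/and5P[_ _ n12 n21 /andP[c1 _]] _ _] _.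
apply/negP => le_e1; case/orP: c1 => c1; first by case/negP: n21; geA_lia.
have [e eq_e] := geA_antisym c1 le_e1.
have Ex1 : x1 = a2 + tors P e - a1 by rewrite -eq_e addrC addKr.
rewrite Ex1 in ndR ntw rk2.
by case: (twin_exists ndR rk2) => Q tw; apply: ntw; exists Q; left.
Qed.

Lemma root_proper (P : {fset nat}) (R : config P) :
  nondegenerate_root R -> non_twin R -> rank2 R -> proper R.
Proof.
move=> ndR ntw rk2; have ndR' := ndR; rewrite -nondegenerate_root_swap in ndR'.
apply/and4P; split.
- exact: root_vec1_proper.
- exact: (root_end1_proper ndR' (non_twin_swap ntw) (rank2_swap rk2)).
- exact: root_end1_proper.
- exact: (root_vec1_proper ndR').
Qed.

(** * The sequence of roots and their iterated sons *)

Lemma nondegenerate_root_ends (P : {fset nat}) (R : config P) :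
  nondegenerate_root R ->
  [/\ is_configuration R, ~~ geA (end1 R) (end2 R) & ~~ geA (end2 R) (end1 R)].
Proof. by case/andP=> /and3P[]. Qed.

(** The parameter of a connection between roots is at least 2, since with 0 or 1
    one of the two configurations would have comparable ends. *)
Lemma root_plusP (P : {fset nat}) (R Q : config P) :
  root_plus R Q ->
  exists k : nat,
    [/\ (1 < k)%N, nonneg (vec2 R), geA (end1 R) (pt2 R),
        geA (pt2 R + vec2 R *+ k) (end1 R)
      & Q = Config (pt1 R) (pt2 R) (vec2 R) (vec2 R *+ k - vec1 R)].
Proof.
case=> /nondegenerate_root_ends[_ _ nge21] /nondegenerate_root_ends[_ nge12' _].
case=> k [/and3P[x2n ge1 gek] _ EQ]; exists k; split=> //.
case: k gek EQ => [|[|k]] // gek EQ.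
- case/negP: nge12'; rewrite EQ; rewrite mulr0n in gek *; geA_lia.
- by case/negP: nge21; rewrite mulr1n in gek; geA_lia.
Qed.

(** The connection with the same parameter goes back; a smaller one would make
    the ends of R comparable. *)
Lemma root_plus_minus (P : {fset nat}) (R Q : config P) :
  root_plus R Q -> root_minus Q R.
Proof.
move=> RQ; have [k [k1 x2n ge1 gek EQ]] := root_plusP RQ.
case: RQ => ndR ndQ _; split=> //; exists k.
have [_ nge12 _] := nondegenerate_root_ends ndR.
rewrite EQ /controls12 /end1 /end2 /=; split.
- apply/and3P; split; [by []|geA_lia|geA_lia].
- move=> j /and3P[_ _ gej]; rewrite leqNgt; apply/negP => lt_jk.
  have gt0 : nonneg (vec2 R *+ (k - j.+1)) by apply: nonnegMn.
  case/negP: nge12.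
  have Ek : k = (k - j.+1 + j.+1)%N by rewrite subnK.
  by rewrite {}[in geA _ _]Ek mulrnDr mulrSr in gej; geA_lia.
- by rewrite opprB addrC subrK; case: (R).
Qed.

Lemma root_minus_plus (P : {fset nat}) (R Q : config P) :
  root_minus R Q -> root_plus Q R.
Proof.
rewrite -[R]swapK -[Q]swapK => /root_minus_swap/root_plus_minus H.
by apply/root_minus_swap; rewrite !swapK in H *.
Qed.

Lemma root_plus_inj (P : {fset nat}) (R Q Q' : config P) :
  root_plus R Q -> root_plus R Q' -> Q = Q'.
Proof.
move=> [_ _ [k [ck mk ->]]] [_ _ [j [cj mj ->]]].
by have -> : k = j by apply/eqP; rewrite eqn_leq mk ?mj.
Qed.

Lemma iter_relSr (T : Type) (r : T -> T -> Prop) n x y z :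
  iter_rel r n x y -> r y z -> iter_rel r n.+1 x z.
Proof.
elim: n x => [|n IH] x /=; first by move=> -> ryz; exists z.
by case=> x' rxx' x'y ryz; exists x' => //; apply: IH ryz.
Qed.

Lemma iter_rel_lastS (T : Type) (r : T -> T -> Prop) n x z :
  iter_rel r n.+1 x z -> exists2 y, iter_rel r n x y & r y z.
Proof.
elim: n x => [|n IH] x; first by case=> y rxy /= ->; exists x.
by case=> x' rxx' /IH[y x'y ryz]; exists y => //; exists x'.
Qed.

Lemma iter_rel_inv (T : Type) (r r' : T -> T -> Prop) n x y :
  (forall a b, r a b -> r' b a) -> iter_rel r n x y -> iter_rel r' n y x.
Proof.
move=> rr'; elim: n y => [|n IH] y; first by move=> /= ->.
move=> xy; have [z xz rzy] := iter_rel_lastS xy.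
by exists z; [apply: rr'|apply: IH].
Qed.

Lemma root_seqS (P : {fset nat}) (R Q Q' : config P) i :
  root_seq R i Q -> root_plus Q Q' -> root_seq R (i + 1) Q'.
Proof.
case: i => n RQ QQ'.
  have -> : n%:Z + 1 = n.+1%:Z by rewrite -addn1.
  exact: iter_relSr RQ QQ'.
have [Z RZ /root_minus_plus ZQ] := iter_rel_lastS RQ.
rewrite (root_plus_inj QQ' ZQ); case: n RQ RZ => [|n] _ RZ; first by [].
by have -> : Negz n.+1 + 1 = Negz n by rewrite !NegzE -addn1 PoszD opprD addrNK.
Qed.

Lemma root_seqP (P : {fset nat}) (R Q Q' : config P) i :
  root_seq R i Q -> root_minus Q Q' -> root_seq R (i - 1) Q'.
Proof.
move=> /root_seq_swap RQ QQ'; apply/root_seq_swap.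
have -> : - (i - 1) = - i + 1 by rewrite opprB addrC.
by apply: root_seqS RQ _; apply/root_minus_swap; rewrite !swapK.
Qed.

Lemma root_seq_plus (P : {fset nat}) (R Q Q' : config P) i n :
  root_seq R i Q -> iter_rel (@root_plus P) n Q Q' -> root_seq R (i + n%:Z) Q'.
Proof.
elim: n Q i => [|n IH] Q i RQ; first by move=> /= ->; rewrite addr0.
case=> Z QZ ZQ'; have := IH _ _ (root_seqS RQ QZ) ZQ'.
by rewrite -addrA -intS.
Qed.

Lemma root_seq_minus (P : {fset nat}) (R Q Q' : config P) i n :
  root_seq R i Q -> iter_rel (@root_minus P) n Q Q' -> root_seq R (i - n%:Z) Q'.
Proof.
elim: n Q i => [|n IH] Q i RQ; first by move=> /= ->; rewrite subr0.
case=> Z QZ ZQ'; have := IH _ _ (root_seqP RQ QZ) ZQ'.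
by rewrite -addrA -opprD -intS.
Qed.

(** The terms of a root sequence are indexed consistently: moving right from
    the i-th term reaches the j-th one. *)
Lemma root_seq_chain (P : {fset nat}) (R Q Q' : config P) i j :
  root_seq R i Q -> root_seq R j Q' -> i <= j ->
  exists2 n, j = i + n%:Z & iter_rel (@root_plus P) n Q Q'.
Proof.
move=> RQ RQ' le_ij; exists `|j - i|%N; first by lia.
have QR : root_seq Q (- i) R.
  case: i RQ {le_ij} => [[|n]|n] RQ; first by rewrite /= RQ.
    exact: iter_rel_inv (@root_plus_minus P) RQ.
  exact: iter_rel_inv (@root_minus_plus P) RQ.
have : root_seq Q (j - i) Q'.
  rewrite addrC; case: j RQ' {le_ij} => n RQ';
    first exact: root_seq_plus QR RQ'.
  by rewrite NegzE; apply: root_seq_minus QR RQ'.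
by have -> : j - i = `|j - i|%N by lia.
Qed.

(** This turns out to be the orbit of R under slides and connections. *)
Definition reached (P : {fset nat}) (R C : config P) : Prop :=
  exists i Q s, root_seq R i Q /\ iterated_son Q s = Some C.

Lemma reached_swap (P : {fset nat}) (R C : config P) :
  reached R C -> reached (swap R) (swap C).
Proof.
move=> [i [Q [s [RQ QC]]]]; exists (- i), (swap Q), (map negb s).
split; first exact/root_seq_swap.
by rewrite iterated_son_swap (mapK negbK) QC.
Qed.

Lemma iterated_son_rcons (P : {fset nat}) (C : config P) s d :
  iterated_son C (rcons s d) =
  if iterated_son C s is Some C' then son d C' else None.
Proof.
elim: s C => [|e s IH] C /=; first by case: son.
by case: (son e C).
Qed.

Lemma iterated_son_cat (P : {fset nat}) (C : config P) s t :
  iterated_son C (s ++ t) =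
  if iterated_son C s is Some C' then iterated_son C' t else None.
Proof. by elim: s C => //= d s IH C; case: son. Qed.

Lemma reached_son (P : {fset nat}) (R C C' : config P) d :
  reached R C -> son d C = Some C' -> reached R C'.
Proof.
move=> [i [Q [s [RQ QC]]]] CC'; exists i, Q, (rcons s d); split=> //.
by rewrite iterated_son_rcons QC.
Qed.

Lemma is_configuration_son (P : {fset nat}) (C C' : config P) d :
  is_configuration C -> son d C = Some C' -> is_configuration C'.
Proof.
have son1 (D D' : config P) : is_configuration D -> son false D = Some D' ->
  is_configuration D'.
  case: D => a1 a2 x1 x2; rewrite /son /is_configuration /end1 /end2 /=.
  case/and5P=> a1n a2n n12 n21 /andP[c1 c2].
  case: ifP => // e1 [<-] /=; apply/and5P; split=> //; rewrite c2 andbT.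
  by case/orP: c2 => c2; apply/orP; [left|right]; geA_lia.
case: d => cC EC; last exact: son1 EC.
rewrite -is_configuration_swap; apply: (son1 (swap C)).
  by rewrite is_configuration_swap.
by rewrite son_swap EC.
Qed.

Lemma proper_son (P : {fset nat}) (C C' : config P) d :
  proper C -> son d C = Some C' -> proper C'.
Proof.
have son1 (D D' : config P) : proper D -> son false D = Some D' -> proper D'.
  case: D => a1 a2 x1 x2; rewrite /son /proper /end1 /end2 /=.
  case/and4P=> p1 p2 p3 p4; case: ifP => // e1 [<-] /=; apply/and4P; split=> //.
    by apply: contra p2 => H; geA_lia.
  by apply: contra p4 => H; geA_lia.
case: d => pC EC; last exact: son1 EC.
rewrite -proper_swap; apply: (son1 (swap C)); first by rewrite proper_swap.
by rewrite son_swap EC.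
Qed.

Lemma proper_iterated_son (P : {fset nat}) (C C' : config P) s :
  is_configuration C -> proper C -> iterated_son C s = Some C' ->
  is_configuration C' /\ proper C'.
Proof.
elim: s C => [|d s IH] C cC pC /=; first by case=> <-.
case EC: (son d C) => [D|] //; apply: IH.
  exact: is_configuration_son EC.
exact: proper_son EC.
Qed.

Lemma proper_root_plus (P : {fset nat}) (R Q : config P) :
  proper R -> root_plus R Q -> proper Q.
Proof.
move=> pR RQ; have [k [k1 x2n e1 ek EQ]] := root_plusP RQ.
have [cR nge12 _] : [/\ is_configuration R, ~~ geA (end1 R) (end2 R) &
  ~~ geA (end2 R) (end1 R)].
  by case: RQ => /nondegenerate_root_ends.
have kx2n : nonneg (vec2 R *+ (k - 2)) by apply: nonnegMn.
have Ek : k = (k - 2).+2 by lia.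
case/and5P: cR => a1n a2n n12 n21 _; case/and4P: pR => p1 p2 p3 p4.
rewrite Ek !mulrS in ek EQ; rewrite EQ.
apply/and4P; split.
- by apply: contra p4 => H; geA_lia.
- by apply: contra nge12 => H; geA_lia.
- by apply: contra n21 => H; geA_lia.
- by apply: contra n21 => H; geA_lia.
Qed.

Lemma proper_root_seq (P : {fset nat}) (R Q : config P) i :
  proper R -> root_seq R i Q -> proper Q.
Proof.
have iter_plus n (C D : config P) : proper C ->
  iter_rel (@root_plus P) n C D -> proper D.
  elim: n C => [|n IH] C pC; first by move=> /= ->.
  by case=> Z /(proper_root_plus pC); apply: IH.
case: i => n pR; first exact: iter_plus.
rewrite -[R]swapK -[Q]swapK => /iter_rel_swap/iter_plus.
by rewrite !proper_swap; apply.
Qed.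

Lemma root_seq_nondegenerate (P : {fset nat}) (R Q : config P) i :
  nondegenerate_root R -> root_seq R i Q -> nondegenerate_root Q.
Proof.
case: i => [[|n]|n] ndR; first by move=> /= ->.
  by move=> RQ; have [Z _ []] := iter_rel_lastS RQ.
by move=> RQ; have [Z _ []] := @iter_rel_lastS _ (@root_minus P) _ _ _ RQ.
Qed.

Lemma reached_proper (P : {fset nat}) (R C : config P) :
  nondegenerate_root R -> proper R -> reached R C ->
  is_configuration C /\ proper C.
Proof.
move=> ndR pR [i [Q [s [RQ QC]]]]; apply: proper_iterated_son QC.
  by case/nondegenerate_root_ends: (root_seq_nondegenerate ndR RQ).
exact: proper_root_seq RQ.
Qed.

(** With the least possible parameter the ends become incomparable, as those of
    R are. *)
Lemma root_plus_exists (P : {fset nat}) (R : config P) k :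
  nondegenerate_root R -> proper R -> controls21 R k ->
  exists k0, [/\ (k0 <= k)%N, controls21 R k0 &
    root_plus R (Config (pt1 R) (pt2 R) (vec2 R) (vec2 R *+ k0 - vec1 R))].
Proof.
move=> ndR pR ck; have exk : exists k, controls21 R k by exists k.
case: (ex_minnP exk) => k0 ck0 k0_min.
exists k0; split; [exact: k0_min|exact: ck0|].
split; [by []| |by exists k0; split].
have [cR nge12 nge21] := nondegenerate_root_ends ndR.
case/and3P: (ck0) => x2n e1 ek.
case/and5P: cR => a1n a2n n12 n21 _; case/and4P: pR => p1 p2 p3 p4.
case: k0 ck0 k0_min ek => [|[|k0]] ck0 k0_min ek.
- by case/negP: p3; rewrite mulr0n in ek; geA_lia.
- by case/negP: nge21; rewrite mulr1n in ek; geA_lia.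
have not_min : ~~ geA (pt2 R + vec2 R *+ k0.+1) (end1 R).
  apply/negP => ek'; suff /k0_min : controls21 R k0.+1 by rewrite ltnn.
  by rewrite /controls21 x2n e1.
have kx2n : nonneg (vec2 R *+ k0) by apply: nonnegMn.
rewrite !mulrS in ek not_min *.
have n1 : nonneg (vec2 R) by [].
rewrite /nondegenerate_root /is_root /is_configuration /degenerate /end1 /end2
  /=.
set x1 := vec1 R in ek not_min p1 p3 *; set x2 :=
  vec2 R in x2n n1 ek kx2n not_min p2 p4 *.
rewrite /end1 /end2 -/x1 -/x2 in nge12 nge21 p1 p2 p3 p4 e1 ek not_min.
set a1 := pt1 R in a1n n12 n21 nge12 nge21 p1 p2 p3 p4 e1 ek not_min *.
set a2 := pt2 R in a2n n12 n21 nge12 nge21 p1 p2 p3 p4 e1 ek not_min *.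
have e2 : geA (a2 + (x2 + (x2 + x2 *+ k0) - x1)) a1 by geA_lia.
have -> /= : geA (a1 + x2) a1 by geA_lia.
rewrite a1n a2n n12 n21 e2 /= andbF orbF.
apply/andP; split; first (apply/andP; split).
- by apply: contra nge12 => H; geA_lia.
- by apply: contra not_min => H; geA_lia.
apply/norP; split; first (apply/norP; split).
- apply: contra p4 => /existsP[e /eqP Ex2].
  by apply/geAP => r; rewrite Ex2; entry_lia.
- apply: contra n21 => /existsP[e /eqP Ex].
  by move: e2; rewrite Ex => e2; geA_lia.
- apply/negP => /andP[/existsP[e /eqP Ex] _].
  by case/negP: n21; apply/geAP=> r; move/nonnegP/(_ r): x2n;
    move: (congr1 (entry r) Ex); entry_lia.
Qed.

Lemma reached_slides (P : {fset nat}) (R : config P) (a1 a2 x1 x2 : A P) n :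
  reached R (Config a1 a2 x1 x2) -> nonneg x1 -> geA (a2 + x2) a1 ->
  reached R (Config a1 a2 x1 (x2 + x1 *+ n)).
Proof.
move=> RC x1n e2; elim: n => [|n IH]; first by rewrite mulr0n addr0.
apply: (@reached_son _ _ _ _ true IH); rewrite /son /end2 /=.
have x1nn : nonneg (x1 *+ n) by apply: nonnegMn.
have -> : geA (a2 + (x2 + x1 *+ n)) a1 by geA_lia.
by rewrite mulrSr addrA.
Qed.

(** By induction on the word leading to the configuration. Connecting after a
    slide of the first end is the same as connecting before it, with a
    parameter less by one; connecting after a slide of the second end amounts
    to undoing that slide, sliding the first end instead, and then sliding the
    second one. From a root, a parameter larger than the least one only adds
    slides. *)
Lemma reached_connection_vec (P : {fset nat}) (R : config P) (a1 a2 x1 x2 : A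
  P) k :
  nondegenerate_root R -> proper R -> reached R (Config a1 a2 x1 x2) ->
  controls21 (Config a1 a2 x1 x2) k ->
  reached R (Config a1 a2 x2 (x2 *+ k - x1)).
Proof.
move=> ndR pR [i [Q [s [RQ QC]]]].
elim/last_ind: s x1 k QC => [|s d IH] x1 k QC.
  case: QC => EQ; rewrite EQ in RQ => ck.
  have ndQ := root_seq_nondegenerate ndR RQ.
  have [k0 [le_k0 /and3P[x2n e1 ek0] QQ']] :=
    root_plus_exists ndQ (proper_root_seq pR RQ) ck.
  have reach0 : reached R (Config a1 a2 x2 (x2 *+ k0 - x1)).
    by exists (i + 1), (Config a1 a2 x2 (x2 *+ k0 - x1)), [::]; split;
      first exact: root_seqS RQ QQ'.
  have := reached_slides (k - k0) reach0 x2n.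
  have -> : x2 *+ k0 - x1 + x2 *+ (k - k0) = x2 *+ k - x1.
    by rewrite addrAC -mulrnDr subnKC.
  by apply; geA_lia.
have rC : reached R (Config a1 a2 x1 x2) by exists i, Q, (rcons s d).
have [_ /and4P[_ _ p3 _]] := reached_proper ndR pR rC.
move=> /and3P[x2n e1 ek].
case: k ek => [|k] ek; first by case/negP: p3; rewrite mulr0n in ek; geA_lia.
move: QC; rewrite iterated_son_rcons.
case EQs: (iterated_son Q s) => [[b1 b2 z1 z2]|] //.
case: d rC => rC; rewrite /son; case: ifP => // ez [E1 E2 E3 E4].
  subst b1 b2 z1; have Ez : z2 = x2 - x1 by rewrite -E4 addrK.
  have rC' : reached R (Config a1 a2 x2 (x2 - x1)).
    apply: (@reached_son _ _ (Config a1 a2 x1 (x2 - x1)) _ false).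
      by exists i, Q, s; rewrite -Ez.
    rewrite /son /end1 /=; rewrite /end1 /= in e1.
    by rewrite e1 [x1 + _]addrC subrK.
  have := reached_slides k rC' x2n.
  have -> : x2 - x1 + x2 *+ k = x2 *+ k.+1 - x1 by rewrite addrAC mulrS.
  by rewrite Ez in ez; apply; geA_lia.
subst b1 b2 z2; have Ez : z1 = x1 - x2 by rewrite -E3 addrK.
have := IH z1 k EQs; rewrite Ez opprB addrA -mulrSr; apply.
rewrite Ez in ez; rewrite mulrS in ek.
by apply/and3P; split; [exact: x2n|exact: ez|geA_lia].
Qed.

(** * The orbit of a root under the moves *)

(** A configuration whose second end dominates the first is not a root, and a
    first son with this property would come from a configuration that is not
    proper. *)
Lemma reached_father (P : {fset nat}) (R : config P) (a1 a2 x1 x2 : A P) :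
  nondegenerate_root R -> proper R -> reached R (Config a1 a2 x1 x2) ->
  geA (a2 + x2) (a1 + x1) -> reached R (Config a1 a2 x1 (x2 - x1)).
Proof.
move=> ndR pR [i [Q [s [RQ]]]].
case/lastP: s => [[EQ]|s d].
  have [_ _ /negP nge21] := nondegenerate_root_ends (root_seq_nondegenerate ndR
    RQ).
  by rewrite EQ /end1 /end2 /= in nge21.
rewrite iterated_son_rcons.
case EQs: (iterated_son Q s) => [[b1 b2 z1 z2]|] //.
have rC : reached R (Config b1 b2 z1 z2) by exists i, Q, s.
rewrite /son; case: d; case: ifP => // ez [E1 E2 E3 E4] e21.
  by rewrite -E4 -E1 -E2 -E3 addrK.
have [_ /and4P[_ _ /negP[]]] := reached_proper ndR pR rC.
by rewrite -E1 -E2 -E3 -E4 in e21; geA_lia.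
Qed.

Lemma same_edgeE (P : {fset nat}) (p q r s : A P) :
  same_edge (p, q) (r, s) -> (p = r /\ q = s) \/ (q = r /\ p = s).
Proof.
by case=> E; [left|right]; split; rewrite ?(congr1 fst E) ?(congr1 snd E);
  move: (congr1 fst E) (congr1 snd E).
Qed.

Lemma same_edges_flip (P : {fset nat}) (g : edge P * edge P) (h : edge P * edge
  P) :
  same_edges g h -> same_edges g (h.2, h.1).
Proof. by case; [right|left]. Qed.

(** Of the four ways of sliding the second edge along the first, two move the
    minimal point a2, against properness; the other two give the second son
    and its inverse. *)
Lemma reached_slide (P : {fset nat}) (R C : config P) (p q r a : A P) :
  nondegenerate_root R -> proper R -> reached R C -> nonneg a ->
  same_edge (p, q) (pt1 C, end1 C) -> same_edge (r, p + a) (pt2 C, end2 C) ->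
  exists2 C', reached R C' & same_edges ((p, q), (r, q + a)) (edges C').
Proof.
case: C => a1 a2 x1 x2 ndR pR rC an /same_edgeE + /same_edgeE;
  rewrite /end1 /end2 /=.
have [cC /and4P[_ _ p3 _]] := reached_proper ndR pR rC.
case/and5P: cC => _ _ n12 n21 _.
case=> [[Ep Eq]|[Eq Ep]] [[Er Ea]|[Ea Er]].
- exists (Config a1 a2 x1 (x2 + x1)).
    apply: (reached_son (d := true) rC).
    have e2 : geA (a2 + x2) a1 by rewrite -Ea Ep; geA_lia.
    by rewrite /son /end2 /= e2.
  have -> : q + a = a2 + (x2 + x1) by rewrite addrA -Ea Ep Eq addrAC.
  by rewrite Ep Eq Er; left; split; left.
- by case/negP: n21; rewrite -Ea Ep; geA_lia.
- exists (Config a1 a2 x1 (x2 - x1)).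
    have e21 : geA (a2 + x2) (a1 + x1) by rewrite -Ea Ep; geA_lia.
    exact: reached_father.
  have -> : q + a = a2 + (x2 - x1) by rewrite Eq addrA -Ea Ep addrAC addrK.
  by rewrite Ep Eq Er; left; split; [right|left].
- by case/negP: p3; rewrite /end1 /= -[X in geA X _]Ea Ep; geA_lia.
Qed.

Lemma reached_connection (P : {fset nat}) (R C : config P) (p q w w1 w2 : A P)
  k :
  nondegenerate_root R -> proper R -> reached R C ->
  nonneg w -> nonneg w1 -> nonneg w2 -> w1 + w2 = w *+ k ->
  same_edge (q, p + w1) (pt1 C, end1 C) -> same_edge (p, p + w) (pt2 C,
    end2 C) ->
  exists2 C', reached R C' & same_edges ((p, q + w2), (q, q + w)) (edges C').
Proof.
case: C => a1 a2 x1 x2 ndR pR rC wn w1n w2n Ek /same_edgeE + /same_edgeE.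
rewrite /end1 /end2 /=.
have [cC /and4P[_ _ _ p4]] := reached_proper ndR pR rC.
case/and5P: cC => _ _ n12 n21 _.
case=> [[Eq E1]|[E1 Eq]] [[Ep Ew]|[Ew Ep]].
- have Ex2 : x2 = w by apply: (addrI a2); rewrite -Ew Ep.
  have Ex1 : x1 = p + w1 - q by rewrite E1 Eq addrC addKr.
  have Ew2 : w2 = w *+ k - w1 by rewrite -Ek addrC addKr.
  exists (Config a1 a2 x2 (x2 *+ k - x1)).
    apply: reached_connection_vec rC _ => //.
    rewrite /controls21 /end1 /= Ex2 wn -Ek -E1 Ep /=.
    by apply/andP; split; geA_lia.
  have -> : q + w2 = p + (w *+ k - x1).
    by rewrite Ew2 Ex1; move: (_ *+ _) => K; A_ring.
  by rewrite Ex2 Ep Eq; right; split; left.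
- by case/negP: p4; rewrite /end2 /= -[X in geA X _]Ew Ep; geA_lia.
- by case/negP: n12; rewrite -E1 Ep; geA_lia.
- by case/negP: p4; rewrite /end2 /= -[X in geA X _]Ew Ep; geA_lia.
Qed.

Lemma same_edge_trans (P : {fset nat}) (e f g : edge P) :
  same_edge e f -> same_edge e g -> same_edge f g.
Proof. by case: e => p q [] -> [] ->; rewrite /same_edge /=; auto. Qed.

Lemma same_edges_trans (P : {fset nat}) (g h k : edge P * edge P) :
  same_edges g h -> same_edges g k -> same_edges h k.
Proof.
by case=> -[g1 g2] [] [k1 k2]; [left|right|right|left]; split;
  apply: same_edge_trans; eassumption.
Qed.

Lemma same_edges_sym (P : {fset nat}) (g h : edge P * edge P) :
  same_edges g h -> same_edges h g.
Proof. by move/same_edges_trans; apply; left; split; left. Qed.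

Lemma reached_move (P : {fset nat}) (R : config P) (g h : edge P * edge P) :
  nondegenerate_root R -> proper R -> move g h ->
  (exists2 C, reached R C & same_edges g (edges C)) ->
  exists2 C, reached R C & same_edges h (edges C).
Proof.
move=> ndR pR gh [C rC gC].
have ndR' : nondegenerate_root (swap R) by rewrite nondegenerate_root_swap.
have pR' : proper (swap R) by rewrite proper_swap.
have rC' : reached (swap R) (swap C) by apply: reached_swap.
suff: exists2 k, same_edges h k &
    exists2 C', reached R C' \/ reached (swap R) C' & same_edges k (edges C').
  case=> k hk [C' []].
    by exists C' => //; apply: same_edges_trans (same_edges_sym hk) _.
  move=> /reached_swap; rewrite swapK => ? kC'; exists (swap C') => //.
  have /= := same_edges_flip kC'.
  exact: same_edges_trans (same_edges_sym hk).
case: gh => [[p [q [r [a [/and4P[_ _ _ an] gE hE]]]]]|].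
  exists ((p, q), (r, q + a)) => //.
  case: (same_edges_trans gE gC) => -[E1 E2] /=.
    by have [C' rC1 EC] := reached_slide ndR pR rC an E1 E2; exists C' => //;
      left.
  by have [C' rC1 EC] := reached_slide ndR' pR' rC' an E1 E2; exists C' => //;
    right.
case=> [p [q [w [w1 [w2 [k [/and5P[_ _ wn w1n w2n] Ek gE hE]]]]]]].
exists ((p, q + w2), (q, q + w)) => //.
case: (same_edges_trans gE gC) => -[E1 E2] /=.
  by have [C' rC1 EC] := reached_connection ndR pR rC wn w1n w2n Ek E1 E2;
    exists C' => //; left.
by have [C' rC1 EC] := reached_connection ndR' pR' rC' wn w1n w2n Ek E1 E2;
  exists C' => //; right.
Qed.

Lemma reached_refl (P : {fset nat}) (R : config P) : reached R R.
Proof. by exists 0, R, [::]; split. Qed.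

Lemma iterated_son_points (P : {fset nat}) (C D : config P) s :
  iterated_son C s = Some D -> pt1 D = pt1 C /\ pt2 D = pt2 C.
Proof.
elim: s C => [|d s IH] C /=; first by case=> ->.
case EC: (son d C) => [C'|] // /IH[-> ->].
by move: EC; rewrite /son; case: d; case: ifP => // _ [<-].
Qed.

Lemma root_seq_points (P : {fset nat}) (R Q : config P) i :
  root_seq R i Q -> pt1 Q = pt1 R /\ pt2 Q = pt2 R.
Proof.
have iter_points n (C D : config P) : iter_rel (@root_plus P) n C D ->
    pt1 D = pt1 C /\ pt2 D = pt2 C.
  elim: n C => [|n IH] C; first by move=> /= ->.
  by case=> Z [_ _ [k [_ _ EZ]]] /IH[-> ->]; rewrite EZ.
case: i => n; first exact: iter_points.
rewrite -[R]swapK -[Q]swapK => /iter_rel_swap/iter_points[].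
by rewrite /= => -> ->.
Qed.

Lemma reached_points (P : {fset nat}) (R C : config P) :
  reached R C -> pt1 C = pt1 R /\ pt2 C = pt2 R.
Proof.
by move=> [i [Q [s [/root_seq_points[<- <-] /iterated_son_points]]]].
Qed.

Lemma reached_obtainable (P : {fset nat}) (a1 a2 v0 v1 y1 y2 : A P) :
  nondegenerate_root (Config a1 a2 v0 v1) -> proper (Config a1 a2 v0 v1) ->
  full_tree (Config a1 a2 y1 y2) ->
  obtainable (Config a1 a2 v0 v1) (Config a1 a2 y1 y2) ->
  reached (Config a1 a2 v0 v1) (Config a1 a2 y1 y2).
Proof.
set R := Config _ _ v0 v1; set D := Config _ _ y1 y2 => ndR pR fD [g Rg gD].
have closed g' h : clos_refl_trans _ (@move P) g' h ->
    (exists2 C, reached R C & same_edges g' (edges C)) ->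
    exists2 C, reached R C & same_edges h (edges C).
  by elim=> {g' h} [g' h|//|g' h k _ IH1 _ IH2 /IH1]; first exact: reached_move.
have [|C rC gC] := closed _ _ Rg.
  by exists R; [exact: reached_refl|left; split; left].
suff <- : C = D by [].
have := reached_points rC; case: C gC rC => b1 b2 x1 x2 gC rC /= [E1 E2].
rewrite E1 E2 in gC rC *; have CD := same_edges_trans gC gD.
have /and5P[/and5P[_ _ n12 n21 _] _ e12 e21 e22] := fD.
rewrite /D /end1 /end2 /= in n12 n21 e12 e21 e22 *.
case: CD => -[/same_edgeE + /same_edgeE]; rewrite /end1 /end2 /=.
- case=> [[_ F1]|[_ F1]]; last by case/negP: n12; rewrite [X in geA X _]F1.
  case=> [[_ F2]|[_ F2]]; last by case/negP: n21; rewrite [X in geA X _]F2.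
  by rewrite (addrI _ F1) (addrI _ F2).
- case=> [[F _]|[_ F]]; first by case/negP: n12; rewrite F geA_refl.
  by move=> _; case/negP: n12; rewrite [X in geA X _]F.
Qed.

(** * Configurations linked by moves *)

Definition linked (P : {fset nat}) (C D : config P) : Prop :=
  clos_refl_trans _ (@move P) (edges C) (edges D).

Lemma linked_refl (P : {fset nat}) (C : config P) : linked C C.
Proof. exact: rt_refl. Qed.

Lemma linked_trans (P : {fset nat}) (C D E : config P) :
  linked C D -> linked D E -> linked C E.
Proof. exact: rt_trans. Qed.

Lemma same_edges_flip_edge (P : {fset nat}) (g : edge P * edge P) (p q : A P)
  (e : edge P) :
  same_edges g ((p, q), e) -> same_edges g ((q, p), e).
Proof.
have flip f : same_edge f (p, q) -> same_edge f (q, p).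
  by case: f => [f1 f2] /same_edgeE[[-> ->]|[-> ->]]; [right|left].
by case=> -[E1 E2]; [left|right]; split=> //; apply: flip.
Qed.

Lemma move_sym (P : {fset nat}) (g h : edge P * edge P) : move g h -> move h g.
Proof.
case=> [[p [q [r [a [/and4P[pn qn rn an] gE hE]]]]]|].
  left; exists q, p, r, a; split;
    [by rewrite pn qn rn|exact: same_edges_flip_edge..].
case=> [p [q [w [w1 [w2 [k [/and5P[pn qn wn w1n w2n] Ek gE hE]]]]]]].
right; exists q, p, w, w2, w1, k; split=> //; first by rewrite pn qn wn w1n w2n.
by rewrite addrC.
Qed.

Lemma linked_sym (P : {fset nat}) (C D : config P) : linked C D -> linked D C.
Proof.
rewrite /linked; elim=> [g h /move_sym gh|g|g h k _ gh _ hk];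
  first exact: rt_step.
  exact: rt_refl.
exact: rt_trans gh.
Qed.

Lemma linked_obtainable (P : {fset nat}) (C D : config P) :
  linked C D -> obtainable C D.
Proof. by move=> CD; exists (edges D) => //; left; split; left. Qed.

Lemma same_edges_refl (P : {fset nat}) (g : edge P * edge P) : same_edges g g.
Proof. by left; split; left. Qed.

Lemma ends_nonneg (P : {fset nat}) (C : config P) :
  is_configuration C -> nonneg (end1 C) /\ nonneg (end2 C).
Proof.
case/and5P=> a1n a2n _ _ /andP[c1 c2].
by split; [case/orP: c1|case/orP: c2] => H; geA_lia.
Qed.

Lemma linked_son (P : {fset nat}) (C C' : config P) d :
  is_configuration C -> son d C = Some C' -> linked C C'.
Proof.
move=> cC EC; apply: rt_step; left; have [e1n e2n] := ends_nonneg cC.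
case/and5P: cC => a1n a2n _ _ _; move: EC; rewrite /son.
case: d; case: ifP => // ge [<-].
  exists (pt1 C), (end1 C), (pt2 C), (end2 C - pt1 C); split.
  - by rewrite a1n a2n e1n /=; exact: ge.
  - by rewrite addrC subrK; apply: same_edges_refl.
  - have -> : end1 C + (end2 C - pt1 C) = pt2 C + (vec2 C + vec1 C).
      by rewrite /end1 /end2; A_ring.
    exact: same_edges_refl.
exists (pt2 C), (end2 C), (pt1 C), (end1 C - pt2 C); split.
- by rewrite a1n a2n e2n /=; exact: ge.
- by rewrite addrC subrK; right; split; left.
- have -> : end2 C + (end1 C - pt2 C) = pt1 C + (vec1 C + vec2 C).
    by rewrite /end1 /end2; A_ring.
  by right; split; left.
Qed.

Lemma linked_root_plus (P : {fset nat}) (R Q : config P) :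
  root_plus R Q -> linked R Q.
Proof.
move=> RQ; have [k [k1 x2n e1 ek EQ]] := root_plusP RQ.
have [cR _ _] : [/\ is_configuration R, ~~ geA (end1 R) (end2 R) &
  ~~ geA (end2 R) (end1 R)].
  by case: RQ => /nondegenerate_root_ends.
case/and5P: cR => a1n a2n _ _ _.
apply: rt_step; right.
exists (pt2 R), (pt1 R), (vec2 R), (end1 R - pt2 R),
  (pt2 R + vec2 R *+ k - end1 R), k; split.
- by rewrite a1n a2n x2n /=; apply/andP; split; [exact: e1|exact: ek].
- by move: (_ *+ _) => K; A_ring.
- by rewrite addrC subrK; apply: same_edges_refl.
- rewrite EQ; have -> : pt1 R + (pt2 R + vec2 R *+ k - end1 R) = pt2 R + (vec2
  R *+ k - vec1 R).
    by rewrite /end1; move: (_ *+ _) => K; A_ring.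
  by right; split; left.
Qed.

Lemma linked_root_seq (P : {fset nat}) (R Q : config P) i :
  root_seq R i Q -> linked R Q.
Proof.
have iter_linked n (C D : config P) : iter_rel (@root_plus P) n C D ->
  linked C D.
  elim: n C => [|n IH] C; first by move=> /= ->; apply: linked_refl.
  by case=> Z /linked_root_plus CZ /IH; apply: linked_trans.
case: i => n; first exact: iter_linked.
move=> H; apply/linked_sym/(iter_linked n.+1).
exact: iter_rel_inv (@root_minus_plus P) H.
Qed.

(** * The plane of the two vectors *)

(** The determinant: its sign compares the directions of two vectors. *)
Definition wedge (u v : int * int) : int := u.1 * v.2 - u.2 * v.1.

Lemma wedgeDl u v w : wedge (u + v) w = wedge u w + wedge v w.
Proof. by rewrite /wedge /=; ring. Qed.

Lemma wedgeC u v : wedge u v = - wedge v u.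
Proof. by rewrite /wedge; ring. Qed.

Lemma wedgeDr u v w : wedge u (v + w) = wedge u v + wedge u w.
Proof. by rewrite /wedge /=; ring. Qed.

Lemma wedgeNr u v : wedge u (- v) = - wedge u v.
Proof. by rewrite /wedge /=; ring. Qed.

Lemma wedgeMr u v n : wedge u (v *+ n) = wedge u v * n%:Z.
Proof.
elim: n => [|n IH]; first by rewrite mulr0n /wedge /=; ring.
by rewrite mulrS wedgeDr IH; lia.
Qed.

Lemma wedge_self u : wedge u u = 0.
Proof. by rewrite /wedge; ring. Qed.

Lemma plucker u v p y :
  wedge u v * wedge p y = wedge p v * wedge u y + wedge u p * wedge v y.
Proof. by rewrite /wedge; ring. Qed.

Lemma wedge_eq u v y :
  wedge u y = 1 -> wedge y v = 0 -> wedge u v = 1 -> y = v.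
Proof.
case: u v y => [u1 u2] [x1 x2] [z1 z2]; rewrite /wedge /= => uy yv uv.
have E1 : z1 = x1.
  transitivity (x1 * (u1 * z2 - u2 * z1) + u1 * (z1 * x2 - z2 * x1) + z1 * (1 -
    (u1 * x2 - u2 * x1))).
    by ring.
  by rewrite uy yv uv; ring.
have E2 : z2 = x2.
  transitivity (x2 * (u1 * z2 - u2 * z1) + u2 * (z1 * x2 - z2 * x1) + z2 * (1 -
    (u1 * x2 - u2 * x1))).
    by ring.
  by rewrite uy yv uv; ring.
by rewrite E1 E2.
Qed.

Lemma wedge_decomp u y b :
  wedge u y = 1 -> wedge b y = 1 -> b = u + y *~ wedge u b.
Proof.
case: u y b => [u1 u2] [x1 x2] [z1 z2]; rewrite /wedge /= => uy yb.
rewrite pairMz; congr pair => /=.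
  transitivity (u1 * (z1 * x2 - z2 * x1) + x1 * (u1 * z2 - u2 * z1) + z1 * (1 -
    (u1 * x2 - u2 * x1))).
    by ring.
  by rewrite yb uy; ring.
transitivity (u2 * (z1 * x2 - z2 * x1) + x2 * (u1 * z2 - u2 * z1) + z2 * (1 -
  (u1 * x2 - u2 * x1))).
  by ring.
by rewrite yb uy; ring.
Qed.

Ltac wedge_lia := rewrite /wedge /=; clear; lia.

Definition comb (P : {fset nat}) (v0 v1 : A P) (u : int * int) : A P :=
  v0 *~ u.1 + v1 *~ u.2.

Section Plane.

Context (P : {fset nat}) (a1 a2 v0 v1 : A P).

Local Notation phi := (comb v0 v1).
Local Notation cf u v := (Config a1 a2 (phi u) (phi v)).

Lemma combD u v : phi (u + v) = phi u + phi v.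
Proof. by rewrite /comb !mulrzDr addrACA. Qed.

Lemma combN u : phi (- u) = - phi u.
Proof. by rewrite /comb !mulrNz -opprD. Qed.

Lemma combMn u n : phi (u *+ n) = phi u *+ n.
Proof.
elim: n => [|n IH]; first by rewrite !mulr0n /comb !mulr0z addr0.
by rewrite !mulrS combD IH.
Qed.

Lemma iterated_son_cone u v s D :
  wedge u v = 1 -> iterated_son (cf u v) s = Some D ->
  exists p q, [/\ D = cf p q, wedge p q = 1, 1 <= wedge p v /\ 0 <= wedge u p
                & 0 <= wedge q v /\ 1 <= wedge u q].
Proof.
elim: s u v => [|[] s IH] u v uv /=.
- by case=> <-; exists u, v; rewrite uv !wedge_self.
- rewrite /son; case: ifP => // _; rewrite -combD.
  case/IH=> [|p [q [-> pq [p1 p2] [q1 q2]]]]; first by move: uv; wedge_lia.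
  exists p, q; split; [by []|by []|split|split].
  + by move: p1 p2; wedge_lia.
  + by [].
  + by move: q1 q2; wedge_lia.
  + by [].
- rewrite /son; case: ifP => // _; rewrite -combD.
  case/IH=> [|p [q [-> pq [p1 p2] [q1 q2]]]]; first by move: uv; wedge_lia.
  exists p, q; split; [by []|by []|split|split].
  + by [].
  + by move: p1 p2; wedge_lia.
  + by [].
  + by move: q1 q2; wedge_lia.
Qed.

Local Notation N u := (nonneg (phi u)).
Local Notation F u := (geA (a1 + phi u) a2).
Local Notation G u := (geA (a2 + phi u) a1).

Definition minimal_points :=
  [&& nonneg a1, nonneg a2, ~~ geA a1 a2 & ~~ geA a2 a1].

Lemma full_treeP u v : minimal_points ->
  reflect [/\ N u, F u, N v & G v] (full_tree (cf u v)).
Proof.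
case/and4P=> a1n a2n n12 n21.
have E a u' : geA (a + phi u') a = N u' by rewrite /geA addrC addKr.
rewrite /full_tree /is_configuration /end1 /end2 /= a1n a2n n12 n21 !E /=.
by apply: (iffP idP) => [/and5P[_ -> -> -> ->]|[-> -> -> ->]].
Qed.

(** The condition that allows a slide of the second end is not affected by the
    slides of the first one, so it holds from the start if it ever does; a
    full-tree configuration satisfies it. *)
Lemma full_tree_son_guards u v : minimal_points ->
  has_full_tree_son (cf u v) -> F u /\ G v.
Proof.
move=> min12 [s]; rewrite /full_tree_word; elim: s u v => [|d s IH] u v /=.
  by case/(full_treeP _ _ min12).
rewrite /son; case: d; case: ifP => //; rewrite /end1 /end2 /= => ge;
  rewrite -combD.
  by move/IH => [].
by move/IH => [].
Qed.

Lemma root_plus_comb u v Q : root_plus (cf u v) Q ->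
  exists k, [/\ (1 < k)%N, N v, F u, G (v *+ k - u) & Q = cf v (v *+ k - u)].
Proof.
move=> /root_plusP[k [k1 Nv Fu ek EQ]]; exists k; split=> //.
  rewrite combD combN combMn; rewrite /end1 /= in ek.
  by move: (phi v *+ k) (phi u) ek; clear=> x y ek; geA_lia.
by rewrite EQ /= combD combN combMn.
Qed.

(** The sequence of vectors turns in a fixed direction and is convex: since
    the parameter of a connection between roots is at least 2, the wedge with
    an earlier vector increases by a non-decreasing amount. *)
Lemma chain_wedge n u v Q :
  wedge u v = 1 -> iter_rel (@root_plus P) n (cf u v) Q ->
  exists u' v', [/\ Q = cf u' v', wedge u' v' = 1,
    0 <= wedge u u' /\ wedge u u' + 1 <= wedge u v',
    -1 <= wedge v u' /\ wedge v u' + 1 <= wedge v v'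
    & (0 < n)%N -> 0 <= wedge v u'].
Proof.
move=> uv; elim: n Q => [|n IH] Q.
  move=> ->; exists u, v; rewrite !wedge_self uv (wedgeC v u) uv.
  by split.
move=> /(@iter_rel_lastS _ _ _ _ _)[Z /IH[c [e [-> ce [c1 c2] [e1 e2] _]]]].
case/root_plus_comb=> k [k1 _ _ _ ->]; exists e, (e *+ k - c).
rewrite !wedgeDr !wedgeNr !wedgeMr wedge_self (wedgeC e c) ce.
have {}k1 : 2 <= k%:Z by [].
split; [by []|by move: ce; lia| | |].
- by split; [lia|]; move: c1 c2 k1; clear; nia.
- by split; [lia|]; move: e1 e2 k1; clear; nia.
- by move=> _; move: e1 e2; clear; lia.
Qed.

Context (min12 : minimal_points) (comb_inj : injective phi).

Lemma full_tree_guards u v : full_tree (cf u v) -> [/\ N u, F u, N v & G v].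
Proof. exact: elimT (full_treeP _ _ min12). Qed.

Lemma config_comb_inj p q p' q' : cf p q = cf p' q' -> p = p' /\ q = q'.
Proof.
by move=> E; split; apply: comb_inj;
  [move: (congr1 (@vec1 P) E)|move: (congr1 (@vec2 P) E)].
Qed.

Lemma iterated_son_in_cone u v s p q :
  wedge u v = 1 -> iterated_son (cf u v) s = Some (cf p q) ->
  [/\ wedge p q = 1, 1 <= wedge p v /\ 0 <= wedge u p
    & 0 <= wedge q v /\ 1 <= wedge u q].
Proof.
move=> uv /(iterated_son_cone uv)[p' [q' [/config_comb_inj[-> ->] ? ? ?]]].
by split.
Qed.

(** The cone is open at its first vector, so that a primitive y can be made the
    second vector of an iterated son. *)
Definition covered C y := exists b1 b2,
  [/\ linked C (cf b1 b2), full_tree (cf b1 b2), wedge b1 b2 = 1,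
      0 < wedge b1 y & 0 <= wedge y b2].

Lemma covered_linked C D y : linked C D -> covered D y -> covered C y.
Proof.
move=> CD [b1 [b2 [? ? ? ? ?]]]; exists b1, b2; split=> //.
exact: linked_trans CD _.
Qed.

Lemma son1E u v : F u -> son false (cf u v) = Some (cf (u + v) v).
Proof. by move=> Fu; rewrite /son /end1 /= Fu combD. Qed.

Lemma son2E u v : G v -> son true (cf u v) = Some (cf u (v + u)).
Proof. by move=> Gv; rewrite /son /end2 /= Gv combD. Qed.

Lemma iterated_son1 u v s : F u ->
  iterated_son (cf u v) (false :: s) = iterated_son (cf (u + v) v) s.
Proof.
move=> Fu; rewrite -[LHS]/(if son false _ is Some C' then _ else _).
by rewrite son1E.
Qed.

Lemma iterated_son2 u v s : G v ->
  iterated_son (cf u v) (true :: s) = iterated_son (cf u (v + u)) s.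
Proof.
move=> Gv; rewrite -[LHS]/(if son true _ is Some C' then _ else _).
by rewrite son2E.
Qed.

Lemma nonneg_addFG u v : F u -> G v -> N (u + v).
Proof. by rewrite combD; move: (phi u) (phi v) => x y Fx Gy; geA_lia. Qed.

Lemma F_addN u v : F u -> N v -> F (u + v).
Proof. by rewrite combD; move: (phi u) (phi v) => x y Fx Ny; geA_lia. Qed.

Lemma G_addN u v : G u -> N v -> G (u + v).
Proof. by rewrite combD; move: (phi u) (phi v) => x y Gx Ny; geA_lia. Qed.

Lemma full_son1 u v : F u -> N v -> G v -> full_tree (cf (u + v) v).
Proof. by move=> Fu Nv Gv; apply/full_treeP => //; split=> //;
  [apply: nonneg_addFG|apply: F_addN]. Qed.

Lemma full_son2 u v : F u -> N u -> G v -> full_tree (cf u (v + u)).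
Proof.
move=> Fu Nu Gv; apply/full_treeP => //.
by split=> //; [rewrite addrC; apply: nonneg_addFG|apply: G_addN].
Qed.

(** There is no gap between full-tree iterated sons of the same configuration.
    If both sons of (u, v) have full-tree iterated sons, then u + v satisfies
    all the conditions, and the full-tree configurations (u + v, u + 2v) and
    (2u + v, u + v) leave no gap at u + v; so one may go on in the son
    whose cone contains y. *)
Lemma cover_tree n s t u v p q p' q' y :
  (size s + size t <= n)%N -> is_configuration (cf u v) -> wedge u v = 1 ->
  iterated_son (cf u v) s = Some (cf p' q) -> full_tree (cf p' q) ->
  iterated_son (cf u v) t = Some (cf p q') -> full_tree (cf p q') ->
  0 <= wedge u y -> 0 <= wedge y v -> 0 < wedge p y -> 0 <= wedge y q ->
  covered (cf u v) y.
Proof.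
elim: n s t u v p q p' q' => [|n IH]
  s t u v p q p' q' size_st cC uv sD fullD tE fullE uy yv py yq.
  have [s0 t0] : s = [::] /\ t = [::] by case: s t size_st {sD tE} => [|? ?]
    [|? ?].
  move: fullE fullD; rewrite s0 t0 in sD tE.
  have [<- <-] := config_comb_inj (congr1 (odflt (cf u v)) tE) => full_uv _.
  have [Ep _] := config_comb_inj (congr1 (odflt (cf u v)) tE).
  by exists u, v; split=> //; [apply: linked_refl|rewrite Ep].
have [p'q [p'v up'] [qv uq]] := iterated_son_in_cone uv sD.
have [pq' [pv up] [q'v uq']] := iterated_son_in_cone uv tE.
have uy' : 0 < wedge u y.
  have := plucker u v p y; rewrite uv mul1r => E; rewrite E in py.
  have yv' : wedge v y <= 0 by move: yv; wedge_lia.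
  move: py pv up yv' uy; clear; nia.
have fullcase : full_tree (cf u v) -> covered (cf u v) y.
  by move=> fullC; exists u, v; split=> //; apply: linked_refl.
case: s size_st sD => [|d s] size_st sD; first by apply: fullcase;
  rewrite (congr1 (odflt (cf u v)) sD : cf u v = _).
case: t size_st tE => [|e t] size_st tE; first by apply: fullcase;
  rewrite (congr1 (odflt (cf u v)) tE : cf u v = _).
have [Fu Gv] : F u /\ G v.
  by apply: full_tree_son_guards => //; exists (d :: s);
    rewrite /full_tree_word sD.
have L1 := linked_son cC (son1E v Fu).
have L2 := linked_son cC (son2E u Gv).
have c1 := is_configuration_son cC (son1E v Fu).
have c2 := is_configuration_son cC (son2E u Gv).
have uv1 : wedge (u + v) v = 1 by move: uv; wedge_lia.
have uv2 : wedge u (v + u) = 1 by move: uv; wedge_lia.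
(* If p lies in the cone of the first son, which starts at u + v, then y, being
   beyond p, is beyond u + v; likewise for q and the second son. *)
have after t1 : iterated_son (cf (u + v) v) t1 = Some (cf p q') ->
  0 < wedge (u + v) y.
  move=> /(iterated_son_in_cone uv1)[_ [pv1 up1] _].
  have := plucker (u + v) v p y; rewrite uv1 mul1r => E; rewrite E in py.
  have yv' : wedge v y <= 0 by move: yv; wedge_lia.
  move: py pv1 up1 yv'; clear; nia.
have before s1 : iterated_son (cf u (v + u)) s1 = Some (cf p' q) ->
  0 <= wedge y (v + u).
  move=> /(iterated_son_in_cone uv2)[_ _ [qv2 uq2]].
  have := plucker u (v + u) q y; rewrite uv2 mul1r [wedge (v + u) y]wedgeC => E.
  have qy : wedge q y <= 0 by move: yq; wedge_lia.
  move: uq2 qv2 uy; rewrite E in qy; move: qy; clear; nia.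
case: d size_st sD; case: e tE => tE size_st sD.
- rewrite (iterated_son2 _ _ Gv) in sD; rewrite (iterated_son2 _ _ Gv) in tE.
  apply: (covered_linked L2).
  by apply: (IH _ _ _ _ _ _ _ _ _ c2 uv2 sD fullD tE fullE) => //;
    [by move: size_st => /=; clear; lia|exact: before sD].
- rewrite (iterated_son2 _ _ Gv) in sD; rewrite (iterated_son1 _ _ Fu) in tE.
  have := after _ tE; have := before _ sD.
  by rewrite addrC wedgeC; move: (wedge _ _) => z; clear; lia.
- rewrite (iterated_son1 _ _ Fu) in sD; rewrite (iterated_son2 _ _ Gv) in tE.
  have [Fuv _] : F (u + v) /\ G v.
    by apply: full_tree_son_guards => //; exists s; rewrite /full_tree_word sD.
  have [_ Guv] : F u /\ G (v + u).
    by apply: full_tree_son_guards => //; exists t; rewrite /full_tree_word tE.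
  have Nuv : N (u + v) by apply: nonneg_addFG.
  case: (ltrP 0 (wedge (u + v) y)) => y_uv.
    apply: (covered_linked L1).
    apply: (IH _ [:: true] _ _ _ _ _ _ _ c1 uv1 sD fullD (iterated_son2 _ [::]
      Gv) _) => //.
    - by move: size_st => /=; clear; lia.
    - exact: full_son2.
    - exact: ltW.
  rewrite addrC in y_uv Nuv.
  apply: (covered_linked L2).
  apply: (IH [:: false] _ _ _ _ _ _ _ _ c2 uv2 (iterated_son1 _ [::]
    Fu) _ tE fullE) => //.
  - by move: size_st => /=; clear; lia.
  - exact: full_son1.
  - by rewrite wedgeC oppr_ge0.
  - by rewrite wedgeC oppr_ge0.
- rewrite (iterated_son1 _ _ Fu) in sD; rewrite (iterated_son1 _ _ Fu) in tE.
  apply: (covered_linked L1).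
  apply: (IH _ _ _ _ _ _ _ _ _ c1 uv1 sD fullD tE fullE) => //;
    first by move: size_st => /=; clear; lia.
  by apply/ltW; apply: after tE.
Qed.

Lemma chain_full_tree_guard n u v Q :
  iter_rel (@root_plus P) n (cf u v) Q -> has_full_tree_son Q -> F u.
Proof.
case: n => [->|n]; first by case/(full_tree_son_guards min12).
by case=> Z /root_plus_comb[k []].
Qed.

(** There is no gap at the vector v common to two successive roots (u, v) and
    (v, w) either, because of their sons (u + v, v) and (v, v + w). *)
Lemma cover_chain n s t u v u' v' p q p' q' y :
  iter_rel (@root_plus P) n (cf u v) (cf u' v') ->
  nondegenerate_root (cf u v) -> wedge u v = 1 ->
  iterated_son (cf u' v') s = Some (cf p' q) -> full_tree (cf p' q) ->
  iterated_son (cf u v) t = Some (cf p q') -> full_tree (cf p q') ->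
  0 <= wedge u y -> 0 <= wedge y v' -> 0 < wedge p y -> 0 <= wedge y q ->
  covered (cf u v) y.
Proof.
elim: n t u v p q' => [|n IH]
  t u v p q' chain ndR uv sD fullD tE fullE uy yv py yq.
  have [Eu Ev] := config_comb_inj chain.
  have [cR _ _] := nondegenerate_root_ends ndR.
  apply: (cover_tree (leqnn _) cR uv _ fullD tE fullE) => //.
    by rewrite -Eu -Ev; exact: sD.
  by rewrite -Ev.
have [Z RZ Zchain] := chain.
have [k [k1 Nv Fu Gw EZ]] := root_plus_comb RZ.
have [_ Gv] : F u /\ G v.
  by apply: full_tree_son_guards => //; exists t; rewrite /full_tree_word tE.
have fertile' : has_full_tree_son (cf u' v').
  by exists s; rewrite /full_tree_word sD.
rewrite EZ in RZ Zchain; have Fv : F v.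
  exact: (chain_full_tree_guard Zchain).
case: (ltrP 0 (wedge v y)) => yv0.
  apply: (covered_linked (linked_root_plus RZ)).
  apply: (IH [:: true] _ _ _ _ Zchain _ _ sD fullD (iterated_son2 _ [::]
    Gw) _) => //.
  - by case: RZ.
  - by rewrite wedgeDr wedgeNr wedgeMr wedge_self (wedgeC v u) uv mul0r sub0r
    opprK.
  - exact: full_son2.
  - exact: ltW.
have [cR _ _] := nondegenerate_root_ends ndR.
have yv' : 0 <= wedge y v by rewrite wedgeC oppr_ge0.
apply: (cover_tree (leqnn _) cR uv (iterated_son1 _ [::] Fu) _ tE fullE) => //.
exact: full_son1.
Qed.

Lemma full_tree_configuration (C : config P) : full_tree C ->
  is_configuration C.
Proof. by case/and5P. Qed.

(** Inside the cone of a full-tree configuration the sons realize the Euclidean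
    algorithm, which reaches every primitive vector of the cone. *)
Lemma full_tree_vector n b1 b2 x y :
  (`|wedge b1 y| + `|wedge y b2| <= n)%N ->
  full_tree (cf b1 b2) -> wedge b1 b2 = 1 -> wedge x y = 1 ->
  0 < wedge b1 y -> 0 <= wedge y b2 ->
  exists b, [/\ linked (cf b1 b2) (cf b y), full_tree (cf b y) & wedge b y = 1].
Proof.
elim: n b1 b2 => [|n IH] b1 b2 size_y full b12 xy y1 y2.
  by move: size_y y1; move: (wedge _ _) (wedge _ _) => z z'; lia.
have [N1 F1 N2 G2] := full_tree_guards full.
have cB := full_tree_configuration full.
have [y0|y_neq0] := eqVneq (wedge y b2) 0.
  have y1E : wedge b1 y = 1.
    have := plucker b1 b2 x y; rewrite b12 xy [wedge b2 y]wedgeC y0.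
    rewrite oppr0 mulr0 addr0 mulr1 => E.
    have x_gt0 : 0 < wedge x b2 by rewrite -(pmulr_lgt0 _ y1) -E.
    move: E y1 x_gt0; move: (wedge x _) (wedge _ y) => z z'; clear; nia.
  have -> : y = b2 by move: y1E y0 b12; exact: wedge_eq.
  by exists b1; split=> //; apply: linked_refl.
case: (ltrP (wedge y b2) (wedge b1 y)) => y12.
  have [||||b [bL bF by1]] := IH (b1 + b2) b2 _ (full_son1 F1 N2 G2) _ xy.
  - by move: size_y y_neq0 y1 y2 y12; rewrite /wedge /=; clear; lia.
  - by move: b12; wedge_lia.
  - by move: y12; wedge_lia.
  - by [].
  by exists b; split=> //; apply: linked_trans (linked_son cB (son1E _ F1)) bL.
have [||||b [bL bF by1]] := IH b1 (b2 + b1) _ (full_son2 F1 N1 G2) _ xy.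
- by move: size_y y1 y2 y12; rewrite /wedge /=; clear; lia.
- by move: b12; wedge_lia.
- by [].
- by move: y12; wedge_lia.
by exists b; split=> //; apply: linked_trans (linked_son cB (son2E _ G2)) bL.
Qed.

Lemma full_tree_slides u v n : full_tree (cf u v) ->
  full_tree (cf (u + v *+ n) v) /\ linked (cf u v) (cf (u + v *+ n) v).
Proof.
move=> full; elim: n => [|n [fulln link]].
  by rewrite mulr0n addr0; split=> //; apply: linked_refl.
have [N1 F1 N2 G2] := full_tree_guards fulln.
rewrite mulrSr addrA; split; first exact: full_son1.
by apply: linked_trans link (linked_son (full_tree_configuration fulln) (son1E
  _ F1)).
Qed.

(** Full-tree configurations with overlapping cones have a common iterated
    son: descend in both to configurations with second vector y1 + y2; they
    differ by a number of slides. *)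
Lemma overlap_linked C y1 y2 :
  full_tree (cf y1 y2) -> wedge y1 y2 = 1 -> covered C (y1 + y2) ->
  linked C (cf y1 y2).
Proof.
set y := y1 + y2 => full y12 [b1 [b2 [Cb bF b12 b1y yb2]]].
have y1y : wedge y1 y = 1 by move: y12; rewrite /y; wedge_lia.
have [b [bL bF' by1]] := full_tree_vector (leqnn _) bF b12 y1y b1y yb2.
have [N1 F1 N2 G2] := full_tree_guards full.
have yF : full_tree (cf y1 y) by rewrite /y addrC; apply: full_son2.
have yL : linked (cf y1 y2) (cf y1 y).
  have -> : y = y2 + y1 by rewrite addrC.
  exact: linked_son (full_tree_configuration full) (son2E _ G2).
apply: linked_trans Cb _; apply: linked_trans bL _;
  apply: linked_trans (linked_sym yL).
have Eb : b = y1 + y *~ wedge y1 b by apply: wedge_decomp.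
case E: (wedge y1 b) => [n|n]; rewrite E in Eb.
  by rewrite Eb -pmulrn; apply/linked_sym; have [] := full_tree_slides n yF.
have -> : y1 = b + y *+ n.+1 by rewrite Eb NegzE mulrNz -pmulrn subrK.
by have [] := full_tree_slides n.+1 bF'.
Qed.
End Plane.

(** * The right limit direction *)

Lemma minimal_prefix (P : {fset nat}) (C : config P) t :
  full_tree_word C t -> exists t' r, t = t' ++ r /\ minimal_full_tree_word C t'.
Proof.
move=> full_t; have exn : exists n, full_tree_word C (take n t).
  by exists (size t); rewrite take_size.
case: (ex_minnP exn) => n full_n n_min.
exists (take n t), (drop n t); split; first by rewrite cat_take_drop.
split=> // s' /prefixP[r Er] neq; apply/negP => full_s'.
have Es' : s' = take (size s') t.
  by rewrite -[t in RHS](cat_take_drop n) Er -catA take_size_cat.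
have := n_min (size s'); rewrite -Es' => /(_ full_s') le_n.
have le_s' : (size s' <= n)%N.
  apply: leq_trans (geq_minl n (size t)).
  by rewrite -size_take_min Er size_cat leq_addr.
by case/eqP: neq; rewrite Es'; congr take; apply/eqP;
  rewrite eqn_leq le_n le_s'.
Qed.

Lemma nonneg_direction (P : {fset nat}) (x y : A P) :
  (forall n, nonneg (x + y *+ n)) -> nonneg y.
Proof.
move=> xy; apply/nonnegP=> r.
have /nonnegP/(_ r) := xy `|entry r x|.+1; rewrite entryD entryMn.
by move: (entry r x) (entry r y) => {xy} a b; clear; nia.
Qed.

Section Limits.

Context (P : {fset nat}) (a1 a2 v0 v1 : A P).

Local Notation phi := (comb v0 v1).
Local Notation cf u v := (Config a1 a2 (phi u) (phi v)).
Local Notation R := (Config a1 a2 v0 v1).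
Local Notation N u := (nonneg (phi u)).
Local Notation F u := (geA (a1 + phi u) a2).
Local Notation G u := (geA (a2 + phi u) a1).

Context (min12 : minimal_points a1 a2) (comb_inj : injective phi).

Lemma config_basis : R = cf (1, 0) (0, 1).
Proof. by rewrite /comb /= !mulr1z !mulr0z addr0 add0r. Qed.

Lemma root_minus_comb u v Q : wedge u v = 1 -> root_minus (cf u v) Q ->
  exists u' v', Q = cf u' v' /\ wedge u' v' = 1.
Proof.
move=> uv [_ _ [k [_ _ ->]]]; exists (u *+ k - v), u.
rewrite combD combN combMn; split=> //.
by rewrite wedgeC wedgeDr wedgeNr wedgeMr wedge_self uv mul0r sub0r opprK.
Qed.

Lemma root_seq_comb i Q : root_seq R i Q ->
  exists u v, Q = cf u v /\ wedge u v = 1.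
Proof.
rewrite config_basis; case: i => n.
  have e01 : wedge (1, 0) (0, 1) = 1 by [].
  by move=> /(chain_wedge e01)[u [v [-> ? _ _ _]]]; exists u, v.
rewrite /root_seq; move: n.+1 => m; elim: m Q => [|m IH] Q.
  by move=> ->; exists (1, 0), (0, 1).
move=> /(@iter_rel_lastS _ _ _ _ _)[Z /IH[u [v [-> uv]]]].
exact: root_minus_comb.
Qed.

Lemma root_seq_wedge i u v : root_seq R i (cf u v) -> wedge u v = 1.
Proof.
by case/root_seq_comb=> u' [v' [/(config_comb_inj comb_inj)[-> ->]]].
Qed.

Lemma root_seq_turn i j u v u' v' :
  root_seq R i (cf u v) -> root_seq R j (cf u' v') -> i <= j ->
  [/\ 0 <= wedge u u' /\ wedge u u' + 1 <= wedge u v',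
    -1 <= wedge v u' /\ wedge v u' + 1 <= wedge v v'
    & i < j -> 0 <= wedge v u'].
Proof.
move=> seq_i seq_j le_ij; have [n Ej chain] := root_seq_chain seq_i seq_j le_ij.
have [c [e [/(config_comb_inj comb_inj)[-> ->] _ ? ? turn]]] :=
  chain_wedge (root_seq_wedge seq_i) chain.
by split=> // lt_ij; apply: turn; lia.
Qed.

(** The properties of a right limit direction w that matter, in a form common to
    finite and infinite sequences of roots. The last one provides, for a
    direction y before w, a full-tree configuration as far to the right as
    desired whose second vector is beyond y; of the two final alternatives, the
    first serves infinite sequences and the second finite ones. *)
Definition right_end (w : int * int) : Prop :=
  [/\ N w, w != 0,
    forall j u v, root_seq R j (cf u v) -> has_full_tree_son (cf u v) ->
      0 <= wedge u w,
    forall j u v s y1 y2, root_seq R j (cf u v) ->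
      iterated_son (cf u v) s = Some (cf y1 y2) -> full_tree (cf y1 y2) ->
      0 <= wedge y1 w /\ 0 <= wedge y2 w
  & forall y j0 u0 v0, 0 < wedge y w -> root_seq R j0 (cf u0 v0) ->
      has_full_tree_son (cf u0 v0) ->
      exists j u v s p q,
        [/\ j0 <= j /\ root_seq R j (cf u v),
            iterated_son (cf u v) s = Some (cf p q), full_tree (cf p q),
            0 < wedge y q & 0 <= wedge y v \/ 0 <= wedge w v]].

Lemma wedge_cone_ge0 u v y z :
  wedge u v = 1 -> 0 <= wedge u y -> 0 <= wedge y v ->
  0 <= wedge u z -> 0 <= wedge v z -> 0 <= wedge y z.
Proof.
move=> uv uy yv uz vz; rewrite -[wedge y z]mul1r -uv plucker.
by apply: addr_ge0; apply: mulr_ge0.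
Qed.

(** At its first difference with any other minimal full-tree word, the extremal
    word s has the digit 1 and the other has 2. If (c1, c2) is reached there,
    the vector c1 + c2 separates the two cones, with that of s on the right. *)
Lemma extremal_right u v s p q t y1 y2 : wedge u v = 1 ->
  extremal_word false (cf u v) s -> iterated_son (cf u v) s = Some (cf p q) ->
  iterated_son (cf u v) t = Some (cf y1 y2) -> full_tree (cf y1 y2) ->
  0 <= wedge y1 q /\ 0 <= wedge y2 q.
Proof.
move=> uv [[_ _] ext_s] sD tE fullE.
have [|t' [r [Et min_t']]] := @minimal_prefix _ (cf u v) t.
  by rewrite /full_tree_word tE.
have [Es|neq] := eqVneq t' s.
  move: tE; rewrite Et Es iterated_son_cat sD => rE.
  have [pq _ _] := iterated_son_in_cone comb_inj uv sD.
  have [_ [? _] [? _]] := iterated_son_in_cone comb_inj pq rE.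
  by split=> //; apply: le_trans (_ : 1 <= _).
have [x [s' [t'' [Es Et']]]] := ext_s _ min_t' neq.
move: sD tE; rewrite Es Et Et' -catA !iterated_son_cat.
case Ex: (iterated_son (cf u v) x) => [X|] //.
have [c1 [c2 [EX c12 _ _]]] := iterated_son_cone uv Ex.
rewrite EX {X Ex EX} => sD tE.
have Fc : F c1.
  by move: sD; rewrite /=; case: ifP.
have Gc : G c2.
  by move: tE; rewrite /=; case: ifP.
rewrite (iterated_son1 _ _ Fc) in sD;
  rewrite cat_cons (iterated_son2 _ _ Gc) in tE.
have c1w : wedge c1 (c2 + c1) = 1 by move: c12; wedge_lia.
have wc2 : wedge (c1 + c2) c2 = 1 by move: c12; wedge_lia.
have [_ _ [qc2 wq]] := iterated_son_in_cone comb_inj wc2 sD.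
have [_ [y1w c1y1] [y2w c1y2]] := iterated_son_in_cone comb_inj c1w tE.
have c1q : 0 <= wedge c1 q by move: qc2 wq; wedge_lia.
have {}wq : 0 <= wedge (c2 + c1) q by rewrite addrC; apply: le_trans wq.
by split; apply: (wedge_cone_ge0 c1w) => //; apply: le_trans (_ : 1 <= _).
Qed.

(** The cones of the earlier roots are on the left of the one that contains w,
    by the convexity of the sequence of vectors. *)
Lemma right_end_finite l i Q s D :
  root_seq R i Q -> has_full_tree_son Q ->
  (forall j Q', root_seq R j Q' -> has_full_tree_son Q' -> j <= i) ->
  extremal_word false Q s -> iterated_son Q s = Some D -> l = vec2 D ->
  exists2 w, l = phi w & right_end w.
Proof.
move=> RQ fQ max_i ext_s sD ->.
have [u [v [EQ uv]]] := root_seq_comb RQ; rewrite EQ in RQ fQ ext_s sD.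
have [p [q [ED pq [pv up] [qv uq]]]] := iterated_son_cone uv sD.
rewrite ED in sD *; exists q => //.
have fullD : full_tree (cf p q).
  by case: ext_s => -[]; rewrite /full_tree_word sD.
have before j u' v' : root_seq R j (cf u' v') -> has_full_tree_son (cf u' v') ->
    0 <= wedge u' q /\ (j < i -> 0 <= wedge v' q).
  move=> seq_j /max_i-/(_ _ seq_j) le_ji.
  have [[a b] [c d] e] := root_seq_turn seq_j RQ le_ji.
  have uq' : 0 <= wedge u q by apply: le_trans uq.
  have bound z : 0 <= wedge z u -> 0 <= wedge z v -> 0 <= wedge z q.
    move=> zu zv; have := plucker u v q z; rewrite uv mul1r => E.
    rewrite wedgeC E; move: zu zv qv uq'; rewrite (wedgeC u z) (wedgeC v z).
    by clear; nia.
  split; first by apply: bound => //; apply: le_trans b; rewrite addr_ge0.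
  move=> /e vu; apply: bound => //; apply: le_trans d.
  by rewrite addr_ge0.
split.
- by have [] := full_tree_guards min12 fullD.
- by apply: contra_eq_neq pq => ->; rewrite /wedge /= !mulr0 subr0.
- by move=> j u' v' seq_j /(before _ _ _ seq_j)[].
- move=> j u' v' t y1 y2 seq_j tE fullE.
  have f_j : has_full_tree_son (cf u' v') by exists t;
    rewrite /full_tree_word tE.
  have [le_ji u'v'] := (max_i _ _ seq_j f_j, root_seq_wedge seq_j).
  have [u'q v'q] := before _ _ _ seq_j f_j.
  case: (ltrP j i) => [lt_ji|le_ij].
    have [_ [y1v uy1] [y2v uy2]] := iterated_son_in_cone comb_inj u'v' tE.
    have {}v'q := v'q lt_ji.
    by split; apply: (wedge_cone_ge0 u'v') => //; apply: le_trans (_ : 1 <= _).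
  have Eij : j = i by apply/eqP; rewrite eq_le le_ji.
  rewrite Eij in seq_j; have [n En chain] := root_seq_chain seq_j RQ (lexx i).
  have n0 : n = 0%N by lia.
  rewrite n0 in chain; have [Eu Ev] := config_comb_inj comb_inj chain.
  by rewrite -Eu -Ev in tE; exact: (extremal_right uv ext_s sD tE fullE).
- move=> y j0 u0 v0' yq seq0 f0; exists i, u, v, s, p, q; split=> //.
  + by split=> //; apply: max_i f0.
  + by right.
Qed.

(** Far to the right the vectors are u + n w. They are nonnegative, hence so is
    w, and their directions converge to that of w. *)
Lemma right_end_infinite l i0 :
  infinite_right R ->
  (forall i Q, i0 <= i -> root_seq R i Q -> l = vec2 Q - vec1 Q) ->
  exists2 w, l = phi w & right_end w.
Proof.
move=> inf lE; pose m := Num.max i0 1.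
have m_ge i : m <= i -> i0 <= i /\ 1 <= i by rewrite ge_max => /andP[].
have seq_at i : 1 <= i -> exists u v, root_seq R i (cf u v).
  move=> i1; have [|Q RQ] := inf i; first exact: le_trans i1.
  by have [u [v [EQ _]]] := root_seq_comb RQ; exists u, v; rewrite -EQ.
have [u [v seq_m]] := seq_at m (proj2 (m_ge _ (lexx m))).
have uv := root_seq_wedge seq_m.
have El : l = phi (v - u) by rewrite (lE _ _ (proj1 (m_ge _ (lexx m))) seq_m)
  combD combN.
set w := v - u in El.
have next i c e : root_seq R i (cf c e) -> 1 <= i -> exists e',
  root_seq R (i + 1) (cf e e') /\ root_plus (cf c e) (cf e e').
  move=> seq_i i1; have [|c' [e' seq_i1]] := seq_at (i + 1); first by lia.
  have [|n En chain] := root_seq_chain seq_i seq_i1; first by lia.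
  have n1 : n = 1%N by lia.
  rewrite n1 in chain; have [Z CZ EZ] := chain; rewrite -EZ in CZ.
  have [k [_ _ _ _ EZ']] := root_plus_comb CZ.
  have [Ec' Ee'] := config_comb_inj comb_inj EZ'.
  by rewrite Ec' in seq_i1 CZ; exists e'.
have arith n : root_seq R (m + n%:Z) (cf (u + w *+ n) (u + w *+ n.+1)).
  elim: n => [|n IH]; first by rewrite !addr0 mulr1n /w addrC subrK.
  have le_m : m <= m + n%:Z by lia.
  have [e' [seq_e _]] := next _ _ _ IH (proj2 (m_ge _ le_m)).
  have -> : m + n.+1%:Z = m + n%:Z + 1 by lia.
  have le_m1 : m <= m + n%:Z + 1 by lia.
  have := lE _ _ (proj1 (m_ge _ le_m1)) seq_e; rewrite El /= -combN -combD.
  move/comb_inj => Ew.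
  have <- : e' = u + w *+ n.+2.
    by rewrite mulrSr addrA; apply/eqP; rewrite addrC -subr_eq -Ew.
  exact: seq_e.
have steps n : N (u + w *+ n.+1) /\ F (u + w *+ n).
  have le_m : m <= m + n%:Z by lia.
  have [e' [_ /root_plus_comb[k [_ ? ? _ _]]]] :=
    next _ _ _ (arith n) (proj2 (m_ge _ le_m)).
  by [].
have Gn n : G (u + w *+ n.+2).
  have le_m : m <= m + n%:Z by lia.
  have [e' [seq_e /root_plus_comb[k [_ _ _ Gk E]]]] :=
    next _ _ _ (arith n) (proj2 (m_ge _ le_m)).
  have le_mm : m + n.+1%:Z <= m + n%:Z + 1 by lia.
  have [n' En' chain] := root_seq_chain (arith n.+1) seq_e le_mm.
  have n0 : n' = 0%N by lia.
  rewrite n0 in chain; have [_ Ee'] := config_comb_inj comb_inj chain.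
  have [_ Ek] := config_comb_inj comb_inj E.
  by rewrite -Ee' Ek.
have uw : wedge u w = 1 by rewrite /w wedgeDr wedgeNr wedge_self uv subr0.
clearbody w.
have beyond j u' v' : root_seq R j (cf u' v') -> 0 <= wedge u' w /\
  0 <= wedge v' w.
  move=> seq_j; have le_j : j <= m + `|j - m|%N%:Z by lia.
  have [[_ A1] [_ A2] _] := root_seq_turn seq_j (arith _) le_j.
  move: A1 A2; rewrite !wedgeDr !wedgeMr intS !mulrDr !mulr1.
  move: (_ * _) (_ * _) => p q.
  move: (wedge u' u) (wedge v' u) (wedge u' w) (wedge v' w).
  by clear=> *; split; lia.
exists w => //; split.
- apply: (@nonneg_direction _ (phi (u + w))) => n.
  rewrite -combMn -combD -addrA -mulrS.
  by case: (steps n).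
- by apply: contra_eq_neq uw => ->; rewrite /wedge /= !mulr0 subr0.
- by move=> j u' v' /beyond[].
- move=> j u' v' t y1 y2 seq_j tE fullE; have [u'w v'w] := beyond _ _ _ seq_j.
  have u'v' := root_seq_wedge seq_j.
  have [_ [y1v uy1] [y2v uy2]] := iterated_son_in_cone comb_inj u'v' tE.
  by split; apply: (wedge_cone_ge0 u'v') => //; apply: le_trans (_ : 1 <= _).
- move=> y j0 u0 v0' yw _ _.
  pose n := (`|(j0 - m)%R| + `|wedge y u|)%N.
  have Fn := proj2 (steps n.+1); have Nn := proj1 (steps n.+1).
  have y_far : 0 < wedge y (u + w *+ n.+2).
    rewrite wedgeDr wedgeMr /n; move: (wedge y u) (wedge y w) yw (absz (j0 -
      m)).
    clear; nia.
  exists (m + n.+1%:Z), (u + w *+ n.+1), (u + w *+ n.+2), [:: false],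
    (u + w *+ n.+1 + (u + w *+ n.+2)), (u + w *+ n.+2); split.
  + by split; [rewrite /n; lia|exact: arith].
  + by rewrite (iterated_son1 _ _ Fn).
  + exact: full_son1.
  + exact: y_far.
  + by left; exact: ltW.
Qed.

Lemma right_limit l : limit_right R l -> exists2 w, l = phi w & right_end w.
Proof.
case=> [[inf [i0 lE]]|[_ [i [Q [s [D [[RQ fQ] max_i ext_s sD lD]]]]]]].
  exact: right_end_infinite inf lE.
exact: (right_end_finite RQ fQ max_i ext_s sD lD).
Qed.
End Limits.

(** * The left limit direction *)

Definition flip (u : int * int) : int * int := (u.2, u.1).

Lemma flipK : involutive flip.
Proof. by case. Qed.

Lemma comb_flip (P : {fset nat}) (v0 v1 : A P) u : comb v1 v0 (flip u) = comb
  v0 v1 u.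
Proof. by rewrite /comb addrC. Qed.

Lemma wedge_flip u v : wedge (flip u) (flip v) = wedge v u.
Proof. by rewrite /wedge /=; ring. Qed.

Section LeftLimit.

Context (P : {fset nat}) (a1 a2 v0 v1 : A P).

Local Notation phi := (comb v0 v1).
Local Notation cf u v := (Config a1 a2 (phi u) (phi v)).
Local Notation R := (Config a1 a2 v0 v1).
Local Notation N u := (nonneg (phi u)).

Context (min12 : minimal_points a1 a2) (comb_inj : injective phi).

Definition left_end (w : int * int) : Prop :=
  [/\ N w, w != 0,
    forall j u v, root_seq R j (cf u v) -> has_full_tree_son (cf u v) ->
      0 <= wedge w v,
    forall j u v s y1 y2, root_seq R j (cf u v) ->
      iterated_son (cf u v) s = Some (cf y1 y2) -> full_tree (cf y1 y2) ->
      0 <= wedge w y1 /\ 0 <= wedge w y2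
  & forall y j0 u0 v0, 0 < wedge w y -> root_seq R j0 (cf u0 v0) ->
      has_full_tree_son (cf u0 v0) ->
      exists j u v s p q,
        [/\ j <= j0 /\ root_seq R j (cf u v),
            iterated_son (cf u v) s = Some (cf p q), full_tree (cf p q),
            0 < wedge p y & 0 <= wedge u y \/ 0 <= wedge u w]].

Lemma minimal_points_swap : minimal_points a2 a1.
Proof. by case/and4P: min12 => ? ? ? ?; apply/and4P; split. Qed.

Lemma comb_swap_inj : injective (comb v1 v0).
Proof.
move=> u v; rewrite -[u]flipK -[v]flipK !(comb_flip v0 v1) => /comb_inj.
by move/(congr1 flip).
Qed.

Lemma left_limit l : limit_left R l -> exists2 w, l = phi w & left_end w.
Proof.
move=> /limit_left_swap/(right_limit minimal_points_swap comb_swap_inj)[w' El].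
rewrite /right_end -[w']flipK; set w := flip w'.
rewrite comb_flip => -[Nw w0 Ra Rb Rc].
have swapE u v : swap (cf u v) = Config a2 a1 (comb v1 v0 (flip v)) (comb v1 v0
  (flip u)).
  by rewrite !comb_flip.
have seqE j u v : root_seq R j (cf u v) ->
    root_seq (Config a2 a1 v1 v0) (- j) (Config a2 a1 (comb v1 v0 (flip v))
      (comb v1 v0 (flip u))).
  by rewrite -swapE => /root_seq_swap.
have fertileE u v : has_full_tree_son (cf u v) ->
    has_full_tree_son (Config a2 a1 (comb v1 v0 (flip v)) (comb v1 v0 (flip
      u))).
  by rewrite -swapE; apply: has_full_tree_son_swap.
exists w; first by rewrite El /w comb_flip.
split.
- exact: Nw.
- by apply: contra_neq w0 => ->.
- by move=> j u v /seqE seq_j /fertileE f_j; rewrite -wedge_flip;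
  apply: Ra seq_j f_j.
- move=> j u v s y1 y2 /seqE seq_j sE fullE.
  rewrite -(wedge_flip y1 w) -(wedge_flip y2 w).
  suff [] : 0 <= wedge (flip y2) (flip w) /\
    0 <= wedge (flip y1) (flip w) by [].
  apply: (Rb _ _ _ (map negb s) _ _ seq_j).
    by rewrite -!swapE iterated_son_swap (mapK negbK) sE.
  by rewrite -swapE full_tree_swap.
- move=> y j0 u0 v0' wy /seqE seq0 /fertileE f0.
  have [|j [u [v [s [p [q [[le_j seq_j] sE fullE yq side]]]]]]] :=
    Rc (flip y) _ _ _ _ seq0 f0.
    by rewrite wedge_flip.
  exists (- j), (flip v), (flip u), (map negb s), (flip q), (flip p).
  have swapE' u' v' : Config a2 a1 (comb v1 v0 u') (comb v1 v0 v') = swap (cf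
    (flip v') (flip u')).
    by rewrite swapE !flipK.
  rewrite !swapE' in seq_j sE fullE; split.
  + split; first by rewrite lerNl.
    by apply/root_seq_swap; rewrite opprK.
  + rewrite -[LHS]/(iterated_son (swap (swap (cf (flip v) (flip u)))) _).
    by rewrite iterated_son_swap (mapK negbK) sE.
  + by rewrite -full_tree_swap.
  + by rewrite -(wedge_flip y) flipK.
  + by rewrite -(wedge_flip y) -(wedge_flip w) flipK.
Qed.
End LeftLimit.

(** * Nielsen equivalence *)

Lemma comb_basis (P : {fset nat}) (a b : A P) :
  comb a b (1, 0) = a /\ comb a b (0, 1) = b.
Proof. by rewrite /comb /= !mulr1z !mulr0z addr0 add0r. Qed.

Lemma comb_comp (P : {fset nat}) (a b : A P) u v w :
  comb (comb a b u) (comb a b v) w = comb a b (u *~ w.1 + v *~ w.2).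
Proof.
rewrite /comb !pairMz /= !mulrzDl !mulrzDr -!mulrzA.
by rewrite addrACA.
Qed.

Lemma nielsen_comb (P : {fset nat}) (x y : A P * A P) :
  nielsen_equiv x y -> exists u v,
    [/\ x.1 = comb y.1 y.2 u, x.2 = comb y.1 y.2 v & wedge u v = 1].
Proof.
pose E (x y : A P * A P) := exists u v,
    [/\ x.1 = comb y.1 y.2 u, x.2 = comb y.1 y.2 v & wedge u v = 1].
rewrite -/(E x y).
have sym z t : E z t -> E t z.
  case: z t => z1 z2 [t1 t2] [u [v /= [-> -> uv]]].
  have [E1 E2] := comb_basis t1 t2.
  exists (v.2, - u.2), (- v.1, u.1); rewrite /= !comb_comp !pairMz.
  split.
  - rewrite -[LHS]E1; congr comb; rewrite /wedge /= in uv *.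
    by congr pair => /=; [rewrite -uv|]; ring.
  - rewrite -[LHS]E2; congr comb; rewrite /wedge /= in uv *.
    by congr pair => /=; [|rewrite -uv]; ring.
  - by rewrite -uv /wedge /=; ring.
have trans z t w : E z t -> E t w -> E z w.
  case: z t w => z1 z2 [t1 t2] [w1 w2] [u [v /= [-> -> uv]]] [p [q /= [-> ->
    pq]]].
  exists (p *~ u.1 + q *~ u.2), (p *~ v.1 + q *~ v.2); rewrite /= !comb_comp.
  split=> //; rewrite !pairMz; transitivity (wedge u v * wedge p q).
    by rewrite /wedge /=; ring.
  by rewrite uv pq.
elim=> {x y} [[x1 x2] y st|x|x y _ IH|x y z _ xy _ yz]; last 1 first.
- exact: trans xy yz.
- apply: sym; case: st => [|[|[|]]] -> /=.
  + by exists (1, 1), (0, 1); rewrite /comb /= !mulr1z !mulr0z add0r.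
  + by exists (1, -1), (0, 1);
    rewrite /comb /= !mulr1z !mulr0z mulrNz mulr1z add0r.
  + by exists (1, 0), (1, 1); rewrite /comb /= !mulr1z !mulr0z addr0 addrC.
  + by exists (1, 0), (-1, 1);
    rewrite /comb /= !mulr1z !mulr0z mulrNz mulr1z addr0 addrC.
- by exists (1, 0), (0, 1); rewrite !(comb_basis _ _).1 !(comb_basis _ _).2.
- exact: sym.
Qed.

Lemma span2E (P : {fset nat}) (a b x : A P) : span2 a b x <-> exists u,
  x = comb a b u.
Proof.
by split=> [[m [n ->]]|[[m n] ->]]; [exists (m, n)|exists m, n].
Qed.

Lemma nielsen_span (P : {fset nat}) (x y : A P * A P) :
  nielsen_equiv x y -> same_span x.1 x.2 y.1 y.2.
Proof.
have incl z t : nielsen_equiv z t -> forall a, span2 z.1 z.2 a ->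
  span2 t.1 t.2 a.
  case/nielsen_comb=> u [v [-> -> _]] a /span2E[w ->].
  by apply/span2E; exists (u *~ w.1 + v *~ w.2); rewrite comb_comp.
by move=> xy a; split; apply: incl => //; apply: rst_sym.
Qed.

Lemma nielsen_son (P : {fset nat}) (C C' : config P) d :
  son d C = Some C' -> nielsen_equiv (vec1 C', vec2 C') (vec1 C, vec2 C).
Proof.
rewrite /son; case: d; case: ifP => // _ [<-] /=; apply/rst_sym/rst_step.
  by right; right; left.
by left.
Qed.

Lemma nielsen_iterated_son (P : {fset nat}) (C D : config P) s :
  iterated_son C s = Some D -> nielsen_equiv (vec1 D, vec2 D) (vec1 C, vec2 C).
Proof.
elim: s C => [|d s IH] C /=; first by case=> ->; apply: rst_refl.
case EC: (son d C) => [C'|] // /IH H.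
exact: rst_trans H (nielsen_son EC).
Qed.

Lemma nielsen_addMn (P : {fset nat}) (x y : A P) n :
  nielsen_equiv (x, y) (x, y + x *+ n).
Proof.
elim: n => [|n IH]; first by rewrite mulr0n addr0; apply: rst_refl.
apply: rst_trans IH _; apply: rst_step; right; right; left.
by rewrite /= mulrSr addrA.
Qed.

Lemma nielsen_rotate (P : {fset nat}) (x y : A P) : nielsen_equiv (x, y) (y,
  - x).
Proof.
apply: (@rst_trans _ _ _ (x + y, y)); first by apply: rst_step; left.
apply: (@rst_trans _ _ _ (x + y, - x)).
  by apply: rst_step; right; right; right; rewrite /= opprD addrCA subrr addr0.
by apply: rst_step; left; rewrite /= addrAC subrr add0r.
Qed.

Lemma nielsen_root_plus (P : {fset nat}) (R Q : config P) :
  root_plus R Q -> nielsen_equiv (vec1 R, vec2 R) (vec1 Q, vec2 Q).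
Proof.
move=> /root_plusP[k [_ _ _ _ ->]] /=.
by apply: rst_trans (nielsen_rotate _ _) _; rewrite addrC; apply: nielsen_addMn.
Qed.

Lemma nielsen_root_seq (P : {fset nat}) (R Q : config P) i :
  root_seq R i Q -> nielsen_equiv (vec1 Q, vec2 Q) (vec1 R, vec2 R).
Proof.
have chain n (C D : config P) : iter_rel (@root_plus P) n C D ->
    nielsen_equiv (vec1 C, vec2 C) (vec1 D, vec2 D).
  elim: n C => [|n IH] C; first by move=> /= ->; apply: rst_refl.
  by case=> Z /nielsen_root_plus CZ /IH; apply: rst_trans.
case: i => n RQ; first by apply: rst_sym; apply: chain RQ.
by apply: (chain n.+1); apply: iter_rel_inv RQ; apply: root_minus_plus.
Qed.

Lemma reached_nielsen (P : {fset nat}) (R C : config P) :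
  reached R C -> nielsen_equiv (vec1 C, vec2 C) (vec1 R, vec2 R).
Proof.
move=> [i [Q [s [/nielsen_root_seq RQ /nielsen_iterated_son QC]]]].
exact: rst_trans QC RQ.
Qed.

Lemma wedge_eq0 wl p q : wedge p q = 1 -> wedge wl p = 0 -> wedge wl q = 0 ->
  wl = 0.
Proof.
case: p q wl => [c d] [c' d'] [e f]; rewrite /wedge /= => pq z1 z2.
congr pair.
  transitivity (e * (c * d' - d * c')); first by rewrite pq mulr1.
  transitivity ((e * d' - f * c') * c - (e * d - f * c) * c'); first by ring.
  by rewrite z1 z2 !mul0r subr0.
transitivity (f * (c * d' - d * c')); first by rewrite pq mulr1.
transitivity ((e * d' - f * c') * d - (e * d - f * c) * d'); first by ring.
by rewrite z1 z2 !mul0r subr0.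
Qed.

(** * Full-tree configurations between the limit directions *)

Section Between.

Context (P : {fset nat}) (a1 a2 v0 v1 : A P).

Local Notation phi := (comb v0 v1).
Local Notation cf u v := (Config a1 a2 (phi u) (phi v)).
Local Notation R := (Config a1 a2 v0 v1).
Local Notation N u := (nonneg (phi u)).

Context (min12 : minimal_points a1 a2) (comb_inj : injective phi).

Lemma entry_plucker r u v w :
  entry r (phi w) * wedge u v = entry r (phi u) * wedge w v + entry r (phi v) *
    wedge u w.
Proof.
have E x : entry r (phi x) = entry r v0 * x.1 + entry r v1 * x.2.
  by rewrite entryD !entryMz.
by rewrite !E /wedge; ring.
Qed.

Lemma entries_neq0 u : u != 0 -> exists r, entry r (phi u) != 0.
Proof.
move=> u0; have [/existsP[r r0]|/existsPn all0] := boolP [exists r : P,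
  entry r (phi u) != 0].
  by exists r.
case/eqP: u0; suff : u *+ 2 = 0.
  by rewrite mulr2n; case: u {all0} => m n [] E1 E2; congr pair; lia.
apply: comb_inj; rewrite combMn.
have /existsP[e /eqP->] : in_tors (phi u).
  by apply: in_torsP => r; have := all0 r; rewrite negbK => /eqP.
by rewrite mulr2n tors_double /comb !mulr0z addr0.
Qed.

(** Wedge wl wr times y1 is a combination of wl and wr with nonnegative
    coefficients. If wedge wl wr were not positive, all entries of both sides
    would vanish, and so would the coefficient of wl, which is wedge y1 wr;
    likewise for y2, and then wr would be 0. *)
Lemma ends_wedge_gt0 wl wr y1 y2 :
  wedge y1 y2 = 1 -> N y1 -> N y2 -> N wl -> N wr -> wl != 0 -> wr != 0 ->
  0 <= wedge wl y1 -> 0 <= wedge wl y2 -> 0 <= wedge y1 wr ->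
    0 <= wedge y2 wr ->
  0 < wedge wl wr.
Proof.
move=> y12 N1 N2 Nl Nr l0 r0 l1 l2 r1 r2; rewrite ltNge; apply/negP => W0.
have [r rl] := entries_neq0 l0.
have key y : N y -> 0 <= wedge wl y -> 0 <= wedge y wr -> wedge y wr = 0.
  move=> Ny ly yr; have := entry_plucker r wl wr y.
  move/nonnegP/(_ r): Ny; move/nonnegP/(_ r): Nl; move/nonnegP/(_ r): Nr.
  move: ly yr W0 rl; move: (entry _ _) (entry _ _) (entry _ _).
  move: (wedge _ _) (wedge _ _) (wedge _ _); clear; nia.
have z1 := key _ N1 l1 r1; have z2 := key _ N2 l2 r2.
case/eqP: r0; apply: (wedge_eq0 y12); first by rewrite wedgeC z1 oppr0.
by rewrite wedgeC z2 oppr0.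
Qed.

(** Cramer's rule. *)
Lemma in_ends_cone wl wr y :
  0 < wedge wl wr -> 0 <= wedge wl y -> 0 <= wedge y wr ->
  exists lambda mu nu : nat,
    (0 < nu)%N /\ phi y *+ nu = phi wl *+ lambda + phi wr *+ mu.
Proof.
move=> W0 ly yr.
exists `|wedge y wr|%N, `|wedge wl y|%N, `|wedge wl wr|%N.
split; first by rewrite absz_gt0 gt_eqF.
rewrite -!combMn -combD; congr comb; rewrite !pmulrn !gez0_abs // ?(ltW W0) //.
rewrite !pairMz; congr pair; rewrite /wedge /=; ring.
Qed.

(** In a sequence infinite on both sides, R itself is full-tree. *)
Lemma full_tree_root_exists l l' : nondegenerate_root R -> limit_left R l ->
  limit_right R l' ->
  exists i u v, root_seq R i (cf u v) /\ has_full_tree_son (cf u v).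
Proof.
move=> ndR.
have from_seq i Q : root_seq R i Q -> has_full_tree_son Q ->
    exists i u v, root_seq R i (cf u v) /\ has_full_tree_son (cf u v).
  move=> RQ fQ; have [u [v [EQ _]]] := root_seq_comb RQ.
  by exists i, u, v; rewrite -EQ.
case=> [[infl _]|[_ [i [Q [s [D [[RQ fQ] _ _ _ _]]]]]]]; last by move=> _;
  exact: (from_seq _ _ RQ fQ).
case=> [[infr _]|[_ [i [Q [s [D [[RQ fQ] _ _ _ _]]]]]]];
  last exact: (from_seq _ _ RQ fQ).
have [//|Q1 [Z RZ _]] := infr 1.
have [//|Q2 [Z' RZ' _]] := infl (-1).
apply: (from_seq 0 R) => //; exists [::]; rewrite /full_tree_word /=.
have [_ [_ N1 F0 _ _]] := root_plusP RZ.
have /root_plusP[_ [_ /= N0 G1 _ _]] : root_plus (swap R) (swap Z').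
  by apply/root_minus_swap; rewrite !swapK.
have [cR _ _] := nondegenerate_root_ends ndR.
rewrite /end1 /= in N0 N1 F0 G1.
by rewrite /full_tree cR /end1 /end2 /= F0 G1 /=; apply/andP; split; geA_lia.
Qed.

Lemma root_minimal_points : nondegenerate_root R -> minimal_points a1 a2.
Proof.
case/nondegenerate_root_ends=> /and5P[/= a1n a2n n12 n21 _] _ _.
by apply/and4P; split.
Qed.

Lemma reached_between wl wr p q :
  left_end a1 a2 v0 v1 wl -> right_end a1 a2 v0 v1 wr ->
  reached R (cf p q) -> full_tree (cf p q) ->
  [/\ wedge p q = 1, 0 < wedge wl wr,
    0 <= wedge wl p /\ 0 <= wedge wl q & 0 <= wedge p wr /\ 0 <= wedge q wr].
Proof.
move=> [Nl l0 _ Lb _] [Nr r0 _ Rb _] [i [Q [s [RQ QD]]]] fullD.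
have [u [v [EQ uv]]] := root_seq_comb RQ; rewrite EQ in RQ QD.
have [pq _ _] := iterated_son_in_cone comb_inj uv QD.
have [lp lq] := Lb _ _ _ _ _ _ RQ QD fullD.
have [pr qr] := Rb _ _ _ _ _ _ RQ QD fullD.
have [Np _ Nq _] := full_tree_guards min12 fullD.
by split=> //; apply: (ends_wedge_gt0 pq).
Qed.

(** The vector p + q lies strictly between the ends, hence between full-tree
    iterated sons of two roots of the sequence. It is covered by some full-tree
    configuration of the orbit, and (p, q) overlaps that one. *)
Lemma between_linked wl wr p q : nondegenerate_root R ->
  left_end a1 a2 v0 v1 wl -> right_end a1 a2 v0 v1 wr ->
  (exists i u v, root_seq R i (cf u v) /\ has_full_tree_son (cf u v)) ->
  full_tree (cf p q) -> wedge p q = 1 -> 0 < wedge wl wr ->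
  0 <= wedge wl p -> 0 <= wedge wl q -> 0 <= wedge p wr -> 0 <= wedge q wr ->
  linked R (cf p q).
Proof.
move=> ndR [_ l0 La _ Lc] [_ r0 Ra _ Rc] [j [u0 [u1 [seq_j f_j]]]]
  full pq W0 lp lq pr qr.
have ly : 0 < wedge wl (p + q).
  rewrite wedgeDr lt_neqAle addr_ge0 // andbT eq_sym paddr_eq0 //.
  by apply: contra l0 => /andP[/eqP l1 /eqP l2]; rewrite (wedge_eq0 pq l1 l2).
have yr : 0 < wedge (p + q) wr.
  rewrite wedgeDl lt_neqAle addr_ge0 // andbT eq_sym paddr_eq0 //.
  apply: contra r0 => /andP[/eqP r1 /eqP r2].
  by rewrite (@wedge_eq0 wr p q pq) // wedgeC ?r1 ?r2 oppr0.
have [i [u [v [t [b [b' [[le_i seq_i] tE fullE by_ side_l]]]]]]] :=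
  Lc _ _ _ _ ly seq_j f_j.
have [k [u' [v' [s [c' [c [[le_k seq_k] sD fullD yc side_r]]]]]]] :=
  Rc _ _ _ _ yr seq_j f_j.
have uy : 0 <= wedge u (p + q).
  case: side_l => // ul.
  have ur : 0 <= wedge u wr by apply: Ra seq_i _; exists t;
    rewrite /full_tree_word tE.
  rewrite -(pmulr_rge0 _ W0) plucker (wedgeC wl u) (wedgeC wr) mulrNN.
  by rewrite addr_ge0 // mulr_ge0 // ltW.
have yv : 0 <= wedge (p + q) v'.
  case: side_r => // rv.
  have lv : 0 <= wedge wl v' by apply: La seq_k _; exists s;
    rewrite /full_tree_word sD.
  by rewrite -(pmulr_rge0 _ W0) plucker addr_ge0 // mulr_ge0 // ltW.
have [n _ chain] := root_seq_chain seq_i seq_k (le_trans le_i le_k).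
apply: linked_trans (linked_root_seq seq_i) _.
apply: (overlap_linked min12 full pq).
apply: (cover_chain min12 comb_inj chain _ _ sD fullD tE fullE) => //.
- exact: root_seq_nondegenerate seq_i.
- exact: root_seq_wedge seq_i.
- exact: ltW.
Qed.
End Between.

Lemma rank2_comb_inj (P : {fset nat}) (a1 a2 v0 v1 : A P) :
  rank2 (Config a1 a2 v0 v1) -> injective (comb v0 v1).
Proof.
move=> rk2 u v E; have : v0 *~ (u - v).1 + v1 *~ (u - v).2 = 0.
  by rewrite -/(comb v0 v1 (u - v)) combD combN E subrr.
case/(rank2_free rk2); case: u v {E} => [m n] [m' n'] /=.
by move=> /eqP; rewrite subr_eq0 => /eqP-> /eqP; rewrite subr_eq0 => /eqP->.
Qed.

Theorem theorem4p7 (P : {fset nat}) (primeP : forall r, r \in P -> prime r)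
    (a1 a2 v0 v1 lminus lplus : A P)
    (rootR : nondegenerate_root (Config a1 a2 v0 v1))
    (non_twinR : non_twin (Config a1 a2 v0 v1))
    (rank2R : rank2 (Config a1 a2 v0 v1))
    (limit_minus : limit_left (Config a1 a2 v0 v1) lminus)
    (limit_plus : limit_right (Config a1 a2 v0 v1) lplus)
    (y1 y2 : A P)
    (full_treeD : full_tree (Config a1 a2 y1 y2)) :
  obtainable (Config a1 a2 v0 v1) (Config a1 a2 y1 y2) <->
  (same_span y1 y2 v0 v1 /\ nielsen_equiv (y1, y2) (v0, v1)) /\
  (forall y : A P, y = y1 \/ y = y2 ->
     exists lambda mu nu : nat,
       (0 < nu)%N /\ y *+ nu = lminus *+ lambda + lplus *+ mu).
Proof.
have min12 := root_minimal_points rootR.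
have inj := rank2_comb_inj rank2R.
have properR := root_proper rootR non_twinR rank2R.
have [wl El endl] := left_limit min12 inj limit_minus.
have [wr Er endr] := right_limit min12 inj limit_plus.
split=> [obt|[[_ niel] cone]].
  have reach := reached_obtainable rootR properR full_treeD obt.
  have niel := reached_nielsen reach.
  split; first by split; [exact: (nielsen_span niel)|exact: niel].
  have [p [q [/= Ep Eq _]]] := nielsen_comb niel.
  rewrite Ep Eq in reach full_treeD *.
  have [_ W0 [lp lq] [pr qr]] :=
    reached_between min12 inj endl endr reach full_treeD.
  by move=> y [->|->]; rewrite El Er; apply: in_ends_cone.
have [p [q [/= Ep Eq pq]]] := nielsen_comb niel.
rewrite Ep Eq in full_treeD cone *.
have [i [u [v [seq_i f_i]]]] :=
  full_tree_root_exists rootR limit_minus limit_plus.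
have W0 : 0 < wedge wl wr.
  have [s] := f_i; rewrite /full_tree_word; case sE: iterated_son => [D|]
    // fullD.
  have [c [e [ED _ _ _]]] := iterated_son_cone (root_seq_wedge inj seq_i) sE.
  rewrite ED in sE fullD.
  have [] := reached_between min12 inj endl endr (ex_intro _ i (ex_intro _ _
    (ex_intro _ s (conj seq_i sE)))) fullD.
  by [].
have inside y : y = p \/ y = q -> 0 <= wedge wl y /\ 0 <= wedge y wr.
  move=> Ey; have [|la [mu [nu [nu0]]]] := cone (comb v0 v1 y).
    by case: Ey => ->; [left|right].
  rewrite El Er -!combMn -combD => /inj E.
  have El' := congr1 (wedge wl) E; have Er' := congr1 (fun z => wedge wr z) E.
  move: El' Er'; rewrite !wedgeDr !wedgeMr !wedge_self (wedgeC wr wl) (wedgeC y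
    wr).
  move: nu0 W0; move: (wedge wl wr) (wedge wl y) (wedge wr y); clear=>
    W l r nu0 W0.
  by move=> H1 H2; split; nia.
have [lp pr] := inside p (or_introl erefl).
have [lq qr] := inside q (or_intror erefl).
apply: linked_obtainable; apply: (between_linked min12 inj rootR endl endr) =>
  //.
by exists i, u, v.
Qed.
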